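(* For any integer $t\ge1$, the semigroup ring $k[H_{3t}]$ is Cohen-Macaulay.
   Context: $k$ is an algebraically closed field of characteristic zero. The semigroups $H_{3t}\subset\mathbb{Z}_{\ge0}^3$ are defined inductively: $H_3:=\langle(3,0,0),(0,3,0),(0,0,3),(1,1,1)\rangle$; with $m=(1,1,1)$, for $t\ge2$, $$H_{3t}:=\langle(3t,0,0),(0,3t,0),(0,0,3t),\,m+H_{3(t-1)}\rangle,$$ where $m+H_{3(t-1)}$ is to be understood as the set of elements $m+h$ with $h$ running over the generators of $H_{3(t-1)}$. Thus $H_{3t}$ is generated by $3t+1$ elements, all of coordinate sum $3t$; e.g. $H_6=\langle(6,0,0),(0,6,0),(0,0,6),(4,1,1),(1,4,1),(1,1,4),(2,2,2)\rangle$. Here $\langle\cdots\rangle$ denotes the semigroup (containing $0$) generated by the listed elements. For a finitely generated semigroup $H\subset\mathbb{Z}^3_{\ge0}$, $k[H]\subseteq k[x_0,x_1,x_2]$ is the graded $k$-subalgebra spanned by the monomials $x_0^{a_0}x_1^{a_1}x_2^{a_2}$ with $(a_0,a_1,a_2)\in H$. *)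

(* Defs.v *)
From HB Require Import structures.
From mathcomp Require Import all_boot all_order all_algebra.
From mathcomp Require Import ring.
From mathcomp Require Import boolp.
From mathcomp Require Import mpoly.

Set Implicit Arguments.
Unset Strict Implicit.
Unset Printing Implicit Defensive.

Import GRing.Theory.
Local Open Scope ring_scope.
Local Open Scope quotient_scope.

(* The type [idealr R] of the library consists of PROPER ideals only, and its
   elements are boolean predicates; classically ([asbool]) every subset is
   one, so quantifying over [idealr R] or [prime_idealr R] covers all proper,
   resp. all prime, ideals. *)

Section Ideals.
Variable R : comNzRingType.

Definition ideal_gen (s : seq R) : {pred R} :=
  fun x => asbool (exists c : 'I_(size s) -> R, x = \sum_i c i * s`_i).

(* The unit ideal, which is not an [idealr], is generated by [:: 1]. *)
Definition noetherian : Prop :=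
  forall I : idealr R, exists s : seq R, I =i ideal_gen s.

Definition maximal_ideal (M : {pred R}) : Prop :=
  idealr_closed M /\
  forall J : idealr R, {subset M <= J} -> {subset J <= M}.

Definition prime_chain (n : nat) (P : nat -> prime_idealr R) : Prop :=
  forall i, (i < n)%N ->
    {subset P i <= P i.+1} /\ ~ {subset P i.+1 <= P i}.

Definition krull_dim (d : nat) : Prop :=
  (exists P, prime_chain d P) /\
  (forall n P, prime_chain n P -> (n <= d)%N).

Definition regular_seq (s : seq R) : Prop :=
  (forall i, (i < size s)%N -> forall x,
     s`_i * x \in ideal_gen (take i s) -> x \in ideal_gen (take i s)) /\
  1 \notin ideal_gen s.

(* For R local with maximal ideal M, this says that R has depth d. *)
Definition depth_in (M : {pred R}) (d : nat) : Prop :=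
  (exists s, [/\ regular_seq s, {subset s <= M} & size s = d]) /\
  (forall s, regular_seq s -> {subset s <= M} -> (size s <= d)%N).

Definition local_max (M : {pred R}) : Prop :=
  maximal_ideal M /\ forall N : {pred R}, maximal_ideal N -> N =i M.

Definition cohen_macaulay_local : Prop :=
  noetherian /\
  exists2 M : {pred R}, local_max M & exists2 d, krull_dim d & depth_in M d.

End Ideals.

Section Localization.
Variables (R : comNzRingType) (M : prime_idealr R).

Definition loc_den := {s : R | s \notin M}.
Definition loc_frac := (R * loc_den)%type.
Implicit Types x y z : loc_frac.

Lemma loc_den1_subproof : 1 \notin M.
Proof. by rewrite idealr1. Qed.
Definition loc_den1 : loc_den := exist _ 1 loc_den1_subproof.

Lemma loc_denM_subproof (s t : loc_den) : val s * val t \notin M.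
Proof. by rewrite prime_idealrM negb_or (valP s) (valP t). Qed.
Definition loc_denM (s t : loc_den) : loc_den :=
  exist _ (val s * val t) (loc_denM_subproof s t).

Definition loc_equiv x y : bool :=
  asbool (exists u : loc_den, val u * (x.1 * val y.2 - y.1 * val x.2) = 0).

Lemma loc_equiv_refl : reflexive loc_equiv.
Proof. by move=> x; apply/asboolP; exists loc_den1; rewrite subrr mulr0. Qed.

Lemma loc_equiv_sym : ssrbool.symmetric loc_equiv.
Proof.
suff H x y : loc_equiv x y -> loc_equiv y x by move=> x y; apply/idP/idP; apply: H.
move=> /asboolP[u Hu]; apply/asboolP; exists u.
by rewrite -opprB mulrN Hu oppr0.
Qed.

Lemma loc_equiv_trans : transitive loc_equiv.
Proof.
move=> y x z /asboolP[u Hu] /asboolP[v Hv]; apply/asboolP.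
exists (loc_denM (loc_denM u v) y.2) => /=.
have -> : sval u * sval v * sval y.2 * (x.1 * val z.2 - z.1 * val x.2) =
  sval v * sval z.2 * (val u * (x.1 * val y.2 - y.1 * val x.2)) +
  sval u * sval x.2 * (val v * (y.1 * val z.2 - z.1 * val y.2)) by rewrite /=; ring.
by rewrite Hu Hv !mulr0 addr0.
Qed.

Canonical loc_equiv_equiv :=
  EquivRel loc_equiv loc_equiv_refl loc_equiv_sym loc_equiv_trans.

Definition localization := {eq_quot loc_equiv}.
HB.instance Definition _ : EqQuotient _ loc_equiv localization :=
  EqQuotient.on localization.
HB.instance Definition _ := Choice.on localization.

Lemma loc_eqP x y :
  reflect (exists u : loc_den, val u * (x.1 * val y.2 - y.1 * val x.2) = 0)
          (x == y %[mod localization]).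
Proof. by rewrite eqmodE /=; apply: asboolP. Qed.

Lemma loc_reprP x : exists u : loc_den,
  val u * (x.1 * val (repr (\pi_localization x)).2 -
           (repr (\pi_localization x)).1 * val x.2) = 0.
Proof. by apply/loc_eqP; rewrite reprK. Qed.

Definition loc_embed := lift_embed localization (fun a : R => (a, loc_den1)).
Canonical loc_embed_pi_morph := PiEmbed loc_embed.

Definition loc_addf x y : loc_frac :=
  (x.1 * val y.2 + y.1 * val x.2, loc_denM x.2 y.2).
Definition loc_add := lift_op2 localization loc_addf.
Lemma loc_pi_add : {morph \pi : x y / loc_addf x y >-> loc_add x y}.
Proof.
move=> x y; unlock loc_add; apply/eqP/loc_eqP => /=.
have [u] := loc_reprP x; have [v] := loc_reprP y.
case: (repr _) => b' t'; case: (repr _) => a' s' /= Hv Hu.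
exists (loc_denM u v) => /=.
set A := sval u * _ in Hu; set B := sval v * _ in Hv.
rewrite [LHS](_ : _ = sval v * sval y.2 * sval t' * A
                    + sval u * sval x.2 * sval s' * B); last by rewrite /A /B; ring.
by rewrite Hu Hv !mulr0 addr0.
Qed.
Canonical loc_pi_add_morph := PiMorph2 loc_pi_add.

Definition loc_oppf x : loc_frac := (- x.1, x.2).
Definition loc_opp := lift_op1 localization loc_oppf.
Lemma loc_pi_opp : {morph \pi : x / loc_oppf x >-> loc_opp x}.
Proof.
move=> x; unlock loc_opp; apply/eqP/loc_eqP => /=.
have [u] := loc_reprP x; case: (repr _) => a' s' /= Hu; exists u.
by rewrite !mulNr -opprD mulrN Hu oppr0.
Qed.
Canonical loc_pi_opp_morph := PiMorph1 loc_pi_opp.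

Definition loc_mulf x y : loc_frac := (x.1 * y.1, loc_denM x.2 y.2).
Definition loc_mul := lift_op2 localization loc_mulf.
Lemma loc_pi_mul : {morph \pi : x y / loc_mulf x y >-> loc_mul x y}.
Proof.
move=> x y; unlock loc_mul; apply/eqP/loc_eqP => /=.
have [u] := loc_reprP x; have [v] := loc_reprP y.
case: (repr _) => b' t'; case: (repr _) => a' s' /= Hv Hu.
exists (loc_denM u v) => /=.
set A := sval u * _ in Hu; set B := sval v * _ in Hv.
rewrite [LHS](_ : _ = sval v * y.1 * sval t' * A
                    + sval u * a' * sval x.2 * B); last by rewrite /A /B; ring.
by rewrite Hu Hv !mulr0 addr0.
Qed.
Canonical loc_pi_mul_morph := PiMorph2 loc_pi_mul.

Lemma loc_addA : associative loc_add.
Proof.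
elim/quotW=> x; elim/quotW=> y; elim/quotW=> z; rewrite !piE.
by apply/eqP/loc_eqP; exists loc_den1 => /=; ring.
Qed.

Lemma loc_addC : commutative loc_add.
Proof.
elim/quotW=> x; elim/quotW=> y; rewrite !piE.
by apply/eqP/loc_eqP; exists loc_den1 => /=; ring.
Qed.

Lemma loc_add0 : left_id (loc_embed 0) loc_add.
Proof.
elim/quotW=> x; rewrite !piE.
by apply/eqP/loc_eqP; exists loc_den1 => /=; ring.
Qed.

Lemma loc_addN : left_inverse (loc_embed 0) loc_opp loc_add.
Proof.
elim/quotW=> x; rewrite !piE.
by apply/eqP/loc_eqP; exists loc_den1 => /=; ring.
Qed.

HB.instance Definition _ :=
  GRing.isZmodule.Build localization loc_addA loc_addC loc_add0 loc_addN.

Lemma loc_mulA : associative loc_mul.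
Proof.
elim/quotW=> x; elim/quotW=> y; elim/quotW=> z; rewrite !piE.
by apply/eqP/loc_eqP; exists loc_den1 => /=; ring.
Qed.

Lemma loc_mulC : commutative loc_mul.
Proof.
elim/quotW=> x; elim/quotW=> y; rewrite !piE.
by apply/eqP/loc_eqP; exists loc_den1 => /=; ring.
Qed.

Lemma loc_mul1 : left_id (loc_embed 1) loc_mul.
Proof.
elim/quotW=> x; rewrite !piE.
by apply/eqP/loc_eqP; exists loc_den1 => /=; ring.
Qed.

Lemma loc_mulDl : left_distributive loc_mul loc_add.
Proof.
elim/quotW=> x; elim/quotW=> y; elim/quotW=> z; rewrite !piE.
by apply/eqP/loc_eqP; exists loc_den1 => /=; ring.
Qed.

Lemma loc_1neq0 : loc_embed 1 != loc_embed 0.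
Proof.
rewrite !piE; apply/asboolP => -[[u uM]] /=.
rewrite !mulr1 subr0 mulr1 => u0.
by move: uM; rewrite u0 rpred0.
Qed.

HB.instance Definition _ := GRing.Zmodule_isComNzRing.Build localization
  loc_mulA loc_mulC loc_mul1 loc_mulDl loc_1neq0.

End Localization.

Definition cohen_macaulay (R : comNzRingType) : Prop :=
  noetherian R /\
  forall M : prime_idealr R, maximal_ideal M ->
    cohen_macaulay_local (localization M).

Section SemigroupRing.
Variables (k : comNzRingType) (n : nat).
Implicit Types (gs : seq 'X_{1..n}) (m : 'X_{1..n}).

(* The subsemigroup of N^n generated by gs, containing 0. *)
Definition semigroup_gen gs : {pred 'X_{1..n}} :=
  fun m => asbool (exists c : 'I_(size gs) -> nat,
    m = (\sum_(i < size gs) (nth 0 gs i *+ c i))%MM).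

Lemma semigroup_gen0 gs : 0%MM \in semigroup_gen gs.
Proof.
apply/asboolP; exists (fun=> 0%N); by rewrite big1.
Qed.

Lemma semigroup_genD gs m1 m2 :
  m1 \in semigroup_gen gs -> m2 \in semigroup_gen gs ->
  (m1 + m2)%MM \in semigroup_gen gs.
Proof.
move=> /asboolP[c1 ->] /asboolP[c2 ->]; apply/asboolP.
exists (fun i => c1 i + c2 i)%N; rewrite -big_split; apply: eq_bigr => i _ /=.
by apply/mnmP => j; rewrite !mnmE !mulmnE mulnDr.
Qed.

Definition monomial_span (H : {pred 'X_{1..n}}) : {pred {mpoly k[n]}} :=
  fun p => asbool (exists (s : seq 'X_{1..n}) (c : 'X_{1..n} -> k),
    {subset s <= H} /\ p = \sum_(m <- s) c m *: 'X_[m]).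

Lemma monomial_spanP (H : {pred 'X_{1..n}}) p :
  reflect {subset msupp p <= H} (p \in monomial_span H).
Proof.
apply: (iffP (asboolP _)) => [[s [c [sH ->]]] m|pH].
  elim: s sH => [|a s IH] sH; first by rewrite big_nil msupp0.
  rewrite big_cons => /msuppD_le; rewrite mem_cat => /orP[/msuppZ_le|].
    by rewrite msuppX inE => /eqP ->; apply: sH; rewrite mem_head.
  by apply: IH => x xs; apply: sH; rewrite in_cons xs orbT.
by exists (msupp p), (fun m => p@_m); split=> //; apply: mpolyE.
Qed.

Lemma monomial_span_subring gs :
  subring_closed (monomial_span (semigroup_gen gs)).
Proof.
split=> [|p q /monomial_spanP pH /monomial_spanP qH|
          p q /monomial_spanP pH /monomial_spanP qH]; apply/monomial_spanP.
- by move=> m; rewrite msupp1 inE => /eqP ->; apply: semigroup_gen0.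
- move=> m /msuppB_le; rewrite mem_cat => /orP[]; [exact: pH|exact: qH].
- move=> m /msuppM_le /allpairsP[[m1 m2] /= [/pH m1H /qH m2H ->]].
  exact: semigroup_genD.
Qed.

Record semigroup_ring gs := SemigroupRing {
  sgr_val :> {mpoly k[n]};
  _ : sgr_val \in monomial_span (semigroup_gen gs)
}.

HB.instance Definition _ gs := [isSub for @sgr_val gs].
HB.instance Definition _ gs := [Choice of semigroup_ring gs by <:].
HB.instance Definition _ gs :=
  GRing.SubChoice_isSubComNzRing.Build {mpoly k[n]} _ (semigroup_ring gs)
    (monomial_span_subring gs).

End SemigroupRing.

Local Open Scope nat_scope.

Definition mnm3 (a b c : nat) : 'X_{1..3} := [multinom [:: a; b; c]].

(* Generators of H_{3t}; the value at t = 0 is a placeholder. *)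
Fixpoint H3_gens (t : nat) : seq 'X_{1..3} :=
  match t with
  | 0 => [::]
  | 1 => [:: mnm3 3 0 0; mnm3 0 3 0; mnm3 0 0 3; mnm3 1 1 1]
  | t'.+1 => [:: mnm3 (3 * t) 0 0, mnm3 0 (3 * t) 0, mnm3 0 0 (3 * t)
              & [seq (mnm3 1 1 1 + h)%MM | h <- H3_gens t']]
  end.

(* Main.v *)
Require Import Defs.
From mathcomp Require Import all_boot all_order all_algebra.
From HB Require Import structures.
From mathcomp Require Import ring zify.
From mathcomp Require Import boolp.
From mathcomp Require Import mpoly.
From mathcomp Require classical_sets.

(** Let n = 3t, let R = k[H_3t], and consider the monomials X, Y, Z given by the
    n-th powers of the three variables, all of which lie in R.

    The semigroup H_3t has an explicit description (mem_H3): apart from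
    congruence conditions, a triple belongs to it unless its residues modulo n
    sum to n and a coordinate with strictly smallest residue is below n. Hence
    in each residue class modulo n the semigroup is empty or a translate of
    n * N^3, and R is a free module over k[X, Y, Z]. Instead of freeness the
    proof uses its effect on regular sequences: for a in k there is a linear
    retraction of R that sends a monomial to a power of a times the foot of its
    X-line (retract). It kills the multiples of X - a, commutes with
    multiplication by Y and Z, and differs from the identity by multiples of
    X - a. Applying such retractions to a relation shows that X - a, Y - b,
    Z - c is a regular sequence as soon as it generates a proper ideal
    (height_regular).

    Let M be a maximal ideal of R. By the Nullstellensatz, X - a, Y - b and
    Z - c lie in M for suitable a, b, c in k, and the sequence stays regular in
    the localization of R at M (regular_seq_localization), so the depth there is
    at least 3. In any ring a regular sequence inside a prime yields a chain of
    primes of the same length (regular_seq_chain), so depth is at most dimension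
    and it remains to exclude chains of primes of length 4. Elements picked in
    the gaps of such a chain would be algebraically independent over k
    (prime_chain_independent), but R lies in a polynomial ring in three
    variables, where four elements are always dependent, as a count of
    monomials shows (mpoly_dependent).

    Noetherianity comes from Hilbert's basis theorem. The Nullstellensatz is
    proved by descent: if K = D[y] is a field, or becomes one on inverting a
    single element, then y is algebraic over D and D itself becomes a field on
    inverting a single element (almost_field_descent). *)

Set Implicit Arguments.
Unset Strict Implicit.
Unset Printing Implicit Defensive.

Import GRing.Theory.
Local Open Scope ring_scope.
Local Open Scope quotient_scope.

(** * Ideals and noetherian rings *)

Section IdealLemmas.
Variable R : comNzRingType.
Implicit Types (I J : {pred R}) (s : seq R).

Definition is_ideal (I : {pred R}) : Prop :=
  0 \in I /\ forall a, {in I &, forall u v, a * u + v \in I}.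

Lemma is_idealD I u v : is_ideal I -> u \in I -> v \in I -> u + v \in I.
Proof. by case=> _ h uI vI; rewrite -[u]mul1r h. Qed.

Lemma is_idealM I a u : is_ideal I -> u \in I -> a * u \in I.
Proof. by case=> I0 h uI; rewrite -[_ * _]addr0 h. Qed.

Lemma is_idealB I u v : is_ideal I -> u \in I -> v \in I -> u - v \in I.
Proof. by case=> _ h uI vI; rewrite addrC -mulN1r h. Qed.

Lemma is_ideal_sum I (T : Type) (r : seq T) (P : pred T) (F : T -> R) :
  is_ideal I -> (forall i, P i -> F i \in I) -> \sum_(i <- r | P i) F i \in I.
Proof.
move=> idI FI; elim/big_ind: _ => //; first by case: idI.
by move=> x y; apply: is_idealD.
Qed.

Lemma idealrP (J : idealr R) : is_ideal J.
Proof. by split=> [|a u v uJ vJ]; rewrite ?rpred0 // rpredD // idealMr. Qed.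

Lemma idealr_of_closed I : idealr_closed I -> exists J : idealr R, J =i I.
Proof.
by move=> cI; exists (HB.pack_for (idealr R) (I : R -> bool) (isIdealr.Build R I cI)).
Qed.

Lemma ideal_gen_ideal s : is_ideal (ideal_gen s).
Proof.
split=> [|a u v /asboolP[c ->] /asboolP[d ->]]; apply/asboolP.
  by exists (fun=> 0); rewrite big1 // => i _; rewrite mul0r.
exists (fun i => a * c i + d i); rewrite mulr_sumr -big_split; apply: eq_bigr => i _ /=.
by rewrite mulrDl mulrA.
Qed.

Lemma mem_ideal_gen s : {subset s <= ideal_gen s}.
Proof.
move=> x xs; apply/asboolP; have hi : (index x s < size s)%N by rewrite index_mem.
exists (fun i => (i == Ordinal hi)%:R); rewrite (bigD1 (Ordinal hi)) //= eqxx mul1r.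
by rewrite nth_index // big1 ?addr0 // => i /negPf ->; rewrite mul0r.
Qed.

Lemma ideal_gen_min s I : is_ideal I -> {subset s <= I} -> {subset ideal_gen s <= I}.
Proof.
move=> idI sI x /asboolP[c ->]; apply: is_ideal_sum => // i _.
by apply: is_idealM => //; apply: sI; rewrite mem_nth.
Qed.

Lemma ideal_gen_sub s1 s2 : {subset s1 <= s2} -> {subset ideal_gen s1 <= ideal_gen s2}.
Proof.
move=> s12; apply: ideal_gen_min; first exact: ideal_gen_ideal.
by move=> x /s12; apply: mem_ideal_gen.
Qed.

Lemma ideal_gen_rcons s a x :
  x \in ideal_gen (rcons s a) -> exists2 y, y \in ideal_gen s & exists b, x = y + b * a.
Proof.
pose K : {pred R} := fun x => asbool (exists2 y, y \in ideal_gen s & exists b, x = y + b * a).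
suff: {subset ideal_gen (rcons s a) <= K} by move=> h /h/asboolP.
have [g0 gl] := ideal_gen_ideal s; apply: ideal_gen_min; first split.
- by apply/asboolP; exists 0 => //; exists 0; rewrite mul0r addr0.
- move=> c u v /asboolP[y ys [b ->]] /asboolP[z zs [d ->]]; apply/asboolP.
  by exists (c * y + z); [apply: gl | exists (c * b + d); ring].
- move=> z; rewrite mem_rcons inE => /orP[/eqP -> | zs]; apply/asboolP.
    by exists 0 => //; exists 1; rewrite add0r mul1r.
  by exists z; [apply: mem_ideal_gen | exists 0; rewrite mul0r addr0].
Qed.

(** Bundled ideals are proper; the unit ideal is generated by 1. *)
Lemma noetherianP : noetherian R <->
  forall I, is_ideal I -> exists s, I =i ideal_gen s.
Proof.
split=> [nR I idI | h I]; last exact/h/idealrP.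
have [I1|nI1] := boolP (1 \in I).
  exists [:: 1] => x.
  have -> : x \in I by rewrite -[x]mulr1; apply: is_idealM.
  rewrite -[x]mulr1; apply/esym/is_idealM; first exact: ideal_gen_ideal.
  by apply: mem_ideal_gen; rewrite mem_head.
have [|J JI] := @idealr_of_closed I; first by case: idI; split.
by have [s Js] := nR J; exists s => x; rewrite -JI.
Qed.

End IdealLemmas.

Lemma is_ideal_preim (R S : comNzRingType) (f : {rmorphism R -> S}) (I : {pred S}) :
  is_ideal I -> is_ideal (fun a : R => f a \in I).
Proof.
case=> I0 Il; split; first by rewrite unfold_in rmorph0.
by move=> a u v; rewrite !unfold_in rmorphD rmorphM; apply: Il.
Qed.

Lemma ideal_gen_image (R S : comNzRingType) (f : {rmorphism R -> S}) (s : seq R) a :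
  a \in ideal_gen s -> f a \in ideal_gen (map f s).
Proof.
move: a; apply: (ideal_gen_min (I := fun a : R => f a \in ideal_gen (map f s))).
  exact/is_ideal_preim/ideal_gen_ideal.
by move=> a sa; rewrite unfold_in; apply: mem_ideal_gen; rewrite map_f.
Qed.

Lemma noetherian_surj (R S : comNzRingType) (f : {rmorphism R -> S}) :
  (forall y, exists x, f x = y) -> noetherian R -> noetherian S.
Proof.
move=> fs /noetherianP nR; apply/noetherianP => I idI.
have [s Is] := nR _ (is_ideal_preim f idI); exists (map f s) => y.
apply/idP/idP => [|yI]; last first.
  move: y yI; apply: ideal_gen_min => // _ /mapP[x xs ->].
  by have := Is x; rewrite (mem_ideal_gen xs) unfold_in.
have [x <-] := fs y => fxI; apply: ideal_gen_image.
by rewrite -Is unfold_in.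
Qed.

(** * Hilbert's basis theorem *)

Section Hilbert.
Variable R : comNzRingType.

Let lead (I : {pred {poly R}}) n : {pred R} :=
  fun a => asbool (exists f, [/\ f \in I, (size f <= n.+1)%N & f`_n = a]).

Let lead_ideal I n : is_ideal I -> is_ideal (lead I n).
Proof.
move=> idI; split=> [|a u v /asboolP[f [fI sf <-]] /asboolP[g [gI sg <-]]]; apply/asboolP.
  by exists 0; rewrite size_poly0 coef0; split => //; case: idI.
exists (a%:P * f + g); rewrite coefD coefCM; split=> //; first by apply: idI.2.
rewrite (leq_trans (size_polyD _ _)) // geq_max sg andbT.
by rewrite mul_polyC (leq_trans (size_scale_leq _ _)).
Qed.

Let lead_leq I n m a : is_ideal I -> (n <= m)%N -> a \in lead I n -> a \in lead I m.
Proof.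
move=> idI nm /asboolP[f [fI sf <-]]; apply/asboolP; exists ('X^(m - n) * f).
split; first exact: is_idealM.
  by rewrite (leq_trans (size_polyMleq _ _)) // size_polyXn; lia.
by rewrite coefXnM ltnNge leq_subr /= subKn.
Qed.

(** The ideals of leading coefficients of the elements of degree n form an
    ascending chain in n, which stops at some N; lifting generators of these
    ideals for n <= N gives generators of I, by induction on the degree. *)
Theorem noetherian_poly : noetherian R -> noetherian {poly R}.
Proof.
move=> /noetherianP nR; apply/noetherianP => I idI.
have [N leadN] : exists N, forall n a, a \in lead I n -> a \in lead I N.
  pose L : {pred R} := fun a => asbool (exists n, a \in lead I n).
  have idL : is_ideal L.
    split=> [|a u v /asboolP[n un] /asboolP[m vm]]; apply/asboolP.
      by exists 0; have [] := lead_ideal 0 idI.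
    exists (maxn n m); apply: (lead_ideal _ idI).2.
      by apply: lead_leq un; rewrite ?leq_maxl.
    by apply: lead_leq vm; rewrite ?leq_maxr.
  have [s Ls] := nR _ idL.
  have [N sN] : exists N, {subset s <= lead I N}.
    have: {subset s <= L} by move=> x xs; rewrite Ls mem_ideal_gen.
    elim: s {Ls} => [|a s IHs] sL; first by exists 0.
    have [|N sN] := IHs; first by move=> x xs; apply: sL; rewrite in_cons xs orbT.
    have /asboolP[n an] := sL a (mem_head _ _).
    exists (maxn n N) => x; rewrite in_cons => /orP[/eqP -> | /sN xN].
      by apply: lead_leq an; rewrite ?leq_maxl.
    by apply: lead_leq xN; rewrite ?leq_maxr.
  exists N => n a an; have : a \in ideal_gen s by rewrite -Ls; apply/asboolP; exists n.
  exact: (ideal_gen_min (lead_ideal N idI)).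
have liftE n : exists F : seq {poly R},
    {subset F <= I} /\ {subset lead I n <= lead (ideal_gen F) n}.
  have [s Ls] := nR _ (lead_ideal n idI).
  have /choice[g gP] : forall a, exists f, a \in lead I n ->
      [/\ f \in I, (size f <= n.+1)%N & f`_n = a].
    move=> a; have [/asboolP[f fP]|_] := boolP (a \in lead I n); first by exists f.
    by exists 0.
  have sI a : a \in s -> a \in lead I n by move=> sa; rewrite Ls mem_ideal_gen.
  exists (map g s); split=> [_ /mapP[a /sI /gP[]] ? _ _ -> //|a].
  rewrite Ls; apply: ideal_gen_min; first exact/lead_ideal/ideal_gen_ideal.
  move=> x xs; have [gI sg gx] := gP x (sI x xs).
  by apply/asboolP; exists (g x); split=> //; rewrite mem_ideal_gen ?map_f.
have /choice[F FP] := liftE.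
pose G := flatten [seq F n | n <- iota 0 N.+1].
have FG n : (n <= N)%N -> {subset F n <= G}.
  move=> nN x xF; apply/flattenP; exists (F n) => //.
  by apply: map_f; rewrite mem_iota.
have idG := ideal_gen_ideal G.
have leadG n a : a \in lead I n -> a \in lead (ideal_gen G) n.
  have low m b : (m <= N)%N -> b \in lead I m -> b \in lead (ideal_gen G) m.
    move=> mN /(FP m).2 /asboolP[f [fF sf fm]]; apply/asboolP; exists f; split=> //.
    by apply: ideal_gen_sub fF; apply: FG.
  have [nN|/ltnW Nn] := leqP n N; first exact: low.
  by move=> /leadN /(low _ _ (leqnn N)); apply: lead_leq.
exists G => f; apply/idP/idP; last first.
  apply: ideal_gen_min => // x /flattenP[_ /mapP[n _ ->]]; exact: (FP n).1.
move: {2}(size f) (leqnn (size f)) => n; elim: n f => [|n IHn] f.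
  by rewrite leqn0 size_poly_eq0 => /eqP -> _; case: idG.
move=> sf fI; have /leadG/asboolP[g [gG sg gn]] : f`_n \in lead I n.
  by apply/asboolP; exists f.
have gI : g \in I.
  move: gG; apply: ideal_gen_min => // x /flattenP[_ /mapP[m _ ->]]; exact: (FP m).1.
rewrite -[f](subrK g); apply: is_idealD => //; apply: IHn; last exact: is_idealB.
apply/leq_sizeP => j nj; rewrite coefB.
have [->|] := eqVneq j n; first by rewrite gn subrr.
move=> jn; rewrite !nth_default ?subrr //.
  by apply: leq_trans sg _; rewrite ltn_neqAle eq_sym jn.
by apply: leq_trans sf _; rewrite ltn_neqAle eq_sym jn.
Qed.

End Hilbert.

(** Stating generation through subrings allows the same hypothesis to serve for
    polynomial presentations and for towers of simple extensions. *)
Definition generated_by (k : fieldType) (R : comNzRingType) (c : k -> R) (s : seq R) :=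
  forall D : {pred R}, subring_closed D -> (forall a, c a \in D) ->
    {subset s <= D} -> forall x, x \in D.

Fixpoint iter_poly (k : comNzRingType) (n : nat) : comNzRingType :=
  if n is n'.+1 then {poly iter_poly k n'} else k.

Lemma noetherian_iter_poly (k : fieldType) n : noetherian (iter_poly k n).
Proof.
elim: n => [|n IHn] /=; last exact: noetherian_poly.
apply/noetherianP => I idI.
have [[a aI a0]|nI] := pselect (exists2 a, a \in I & a != 0).
  exists [:: 1] => x; rewrite -{1}[x](divfK a0) is_idealM //.
  rewrite -[x]mulr1 is_idealM ?mem_ideal_gen ?mem_head //; exact: ideal_gen_ideal.
exists [::] => x; apply/idP/idP => [xI|/asboolP[c ->]].
  have [->|x0] := eqVneq x 0; first by have [] := ideal_gen_ideal ([::] : seq k).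
  by case: nI; exists x.
by rewrite big_ord0; case: idI.
Qed.

Lemma noetherian_generated (k : fieldType) (R : comNzRingType)
  (c : {rmorphism k -> R}) s : generated_by c s -> noetherian R.
Proof.
move=> gs; suff [f fs] : exists f : {rmorphism iter_poly k (size s) -> R},
    (forall a, exists p, f p = c a) /\ {in s, forall x, exists p, f p = x}.
  apply: (noetherian_surj (f := f)); last exact: noetherian_iter_poly.
  suff im x : x \in (fun x => asbool (exists p, f p = x) : bool).
    by move=> x; apply/asboolP/im.
  apply: gs x => [|a|x xs]; last by apply/asboolP/fs.2.
    split=> [|_ _ /asboolP[p <-] /asboolP[q <-]|_ _ /asboolP[p <-] /asboolP[q <-]];
    apply/asboolP.
    - by exists 1; rewrite rmorph1.
    - by exists (p - q); rewrite rmorphB.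
    - by exists (p * q); rewrite rmorphM.
  by apply/asboolP/fs.1.
elim: s {gs} => [|y s [f [fc fs]]] /=; first by exists c; split=> // a; exists a.
have hc : commr_rmorph f y by move=> p; apply: mulrC.
have hC p : horner_morph hc p%:P = f p := horner_morphC hc p.
have hX : horner_morph hc 'X = y := horner_morphX hc.
exists (horner_morph hc); split=> [a|x].
  by have [p <-] := fc a; exists p%:P; apply: hC.
rewrite in_cons => /orP[/eqP ->|/fs[p <-]]; first by exists 'X; apply: hX.
by exists p%:P; apply: hC.
Qed.

(** * Regular sequences and chains of primes *)

Section PrimeChains.
Variable R : comNzRingType.
Implicit Types (I : {pred R}) (s : seq R) (P : prime_idealr R).

Lemma prime_of_closed I : idealr_closed I -> prime_idealr_closed I ->
  exists P : prime_idealr R, P =i I.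
Proof.
move=> cI pI; exists (HB.pack_for (prime_idealr R) (I : R -> bool)
  (isIdealr.Build R I cI) (isPrimeIdealrClosed.Build R I pI)).
by [].
Qed.

(** An ideal maximal among those that avoid S is prime: the ideals spanned by
    it and u, resp. v, both meet S, hence so does the one spanned by u * v. *)
Lemma prime_avoiding (I S : {pred R}) : is_ideal I ->
    1 \in S -> {in S &, forall a b, a * b \in S} -> (forall x, x \in I -> x \notin S) ->
  exists2 P : prime_idealr R, {subset I <= P} & forall x, x \in P -> x \notin S.
Proof.
move=> idI S1 SM IS.
pose good (J : {pred R}) :=
  [/\ is_ideal J, {subset I <= J} & forall x, x \in J -> x \notin S].
pose T := {J : R -> bool | good J}.
pose c (J : T) : {pred R} := sval J.
have cP (J : T) : good (c J) by exact: svalP.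
pose sub (J K : T) := asbool {subset c J <= c K}.
have subP J K : sub J K <-> {subset c J <= c K} by split=> /asboolP.
have goodI : good I by split.
have [||A Atot|J Jmax] :=
  @classical_sets.ZL_preorder T (exist _ I goodI) sub.
- by move=> J; apply/subP.
- by move=> J K L /subP JK /subP KL; apply/subP => x /JK /KL.
- have [[J0 AJ0]|nA] := pselect (exists J, A J); last first.
    by exists (exist _ I goodI) => J AJ; case: nA; exists J.
  pose U : {pred R} := fun x => asbool (exists2 J, A J & x \in c J).
  have goodU : good U.
    split=> [|x xI|x /asboolP[J AJ xJ]]; last 1 first.
    - by have [_ _] := cP J; apply.
    - split=> [|a u v /asboolP[J AJ uJ] /asboolP[K AK vK]]; apply/asboolP.
        by exists J0 => //; have [[]] := cP J0.
      have [/subP JK|/subP KJ] := Atot J K AJ AK.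
        by exists K => //; have [[_ idK] _ _] := cP K; apply: idK => //; apply: JK.
      by exists J => //; have [[_ idJ] _ _] := cP J; apply: idJ => //; apply: KJ.
    - by apply/asboolP; exists J0 => //; have [_ h _] := cP J0; apply: h.
  exists (exist _ U goodU) => J AJ; apply/subP => x xJ.
  by apply/asboolP; exists J.
have [idJ IJ JS] := cP J.
have meet u : u \notin c J -> exists2 j, j \in c J & exists a, j + a * u \in S.
  move=> uJ; apply: contrapT => nS.
  pose K : {pred R} := fun x => asbool (exists2 j, j \in c J & exists a, x = j + a * u).
  have JK : {subset c J <= K}.
    by move=> x xJ; apply/asboolP; exists x => //; exists 0; rewrite mul0r addr0.
  have gK : good K.
    split=> [|x /IJ /JK //|_ /asboolP[j jJ [a ->]]]; last first.
      by apply/negP => h; case: nS; exists j => //; exists a.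
    split=> [|d _ _ /asboolP[i iJ [a ->]] /asboolP[j jJ [b ->]]]; apply/asboolP.
      by exists 0; [case: idJ | exists 0; rewrite mul0r addr0].
    exists (d * i + j); first by apply: idJ.2.
    by exists (d * a + b); ring.
  have /Jmax/subP KJ : sub J (exist _ K gK) by apply/subP.
  case/negP: uJ; apply: KJ; apply/asboolP; exists 0; first by case: idJ.
  by exists 1; rewrite add0r mul1r.
have J1 : 1 \notin c J by apply/negP => /JS; rewrite S1.
have [||P PJ] := @prime_of_closed (c J).
- by case: idJ.
- move=> u v uvJ; apply: contraT; rewrite negb_or => /andP[/meet[i iJ [a aS]] /meet[j jJ [b bS]]].
  have := SM _ _ aS bS; apply: contraTT => _; apply: JS.
  have -> : (i + a * u) * (j + b * v) = (j + b * v) * i + ((a * u) * j + (a * b) * (u * v)).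
    by ring.
  by apply: (is_idealD idJ); [apply: is_idealM | apply: idJ.2 => //; apply: is_idealM].
exists P => x; rewrite PJ; [exact: IJ | exact: JS].
Qed.

(** A prime P minimal over I consists of zero divisors modulo I: otherwise an
    ideal avoiding the products a * x ^+ j with a outside P would yield a
    smaller prime. *)
Lemma prime_below I P x : is_ideal I -> {subset I <= P} -> x \in P ->
    (forall a, x * a \in I -> a \in I) ->
  exists Q : prime_idealr R, [/\ {subset I <= Q}, {subset Q <= P} & x \notin Q].
Proof.
move=> idI IP xP xreg.
pose S : {pred R} := fun y => asbool (exists a j, a \notin P /\ y = a * x ^+ j).
have [||y yI|Q IQ QS] := @prime_avoiding I S idI.
- by apply/asboolP; exists 1, 0%N; rewrite idealr1 mulr1.
- move=> _ _ /asboolP[a [i [aP ->]]] /asboolP[b [j [bP ->]]]; apply/asboolP.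
  exists (a * b), (i + j)%N; rewrite prime_idealrM negb_or aP bP exprD; split=> //.
  by ring.
- apply/asboolP => -[a [j [/negP aP def_y]]]; case: aP; apply: IP.
  move: yI; rewrite {}def_y; elim: j => [|j IHj]; first by rewrite mulr1.
  by rewrite exprS mulrCA => /xreg.
exists Q; split=> // [y yQ|].
  apply: contraT => yP; have /asboolP[] := QS y yQ.
  by exists y, 0%N; rewrite mulr1.
by apply/negP => /QS/asboolP[]; exists 1, 1%N; rewrite idealr1 mul1r.
Qed.

(** Dimension bounds depth: each element of a regular sequence allows one more
    step down from a prime that contains the sequence. *)
Lemma regular_seq_chain s P : regular_seq s -> {subset s <= P} ->
  exists2 Q : nat -> prime_idealr R, prime_chain (size s) Q & Q (size s) = P.
Proof.
case=> sreg _ sP.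
suff chain i (Q : prime_idealr R) : (i <= size s)%N -> {subset take i s <= Q} ->
    exists2 F : nat -> prime_idealr R, prime_chain i F & F i = Q.
  by apply: chain; rewrite ?take_size.
elim: i Q => [|i IHi] Q si sQ; first by exists (fun=> Q).
have sE : take i.+1 s = rcons (take i s) s`_i by rewrite (take_nth 0).
have [||||Q' [IQ' Q'Q xQ']] := @prime_below (ideal_gen (take i s)) Q s`_i.
- exact: ideal_gen_ideal.
- apply: ideal_gen_min; first exact: idealrP.
  by move=> x xs; apply: sQ; rewrite sE mem_rcons inE xs orbT.
- by apply: sQ; rewrite sE mem_rcons mem_head.
- by move=> a; apply: sreg.
have [|F Fchain Fi] := IHi Q' (ltnW si) _.
  by move=> x /mem_ideal_gen /IQ'.
exists (fun j => if (j <= i)%N then F j else Q); last by rewrite ltnn.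
move=> j; rewrite ltnS leq_eqVlt /= => /orP[/eqP ->|ji].
  rewrite eqxx ltnn Fi; split=> // h.
  by case/negP: xQ'; apply: h; apply: sQ; rewrite sE mem_rcons mem_head.
by rewrite ji orbT; apply: Fchain.
Qed.

(** In a local ring every question about dimension and depth is settled by a
    regular sequence whose length bounds the chains of primes. *)
Lemma cohen_macaulay_local_of (M : {pred R}) d : noetherian R -> local_max M ->
    (exists s, [/\ regular_seq s, {subset s <= M} & size s = d]) ->
    (forall n (P : nat -> prime_idealr R), prime_chain n P -> (n <= d)%N) ->
  cohen_macaulay_local R.
Proof.
move=> nR locM [s [sreg sM sd]] dimR; split=> //.
have [P PM] : exists P : prime_idealr R, P =i M.
  have [[[M0 M1 Ml] Mmax] _] := locM; apply: prime_of_closed => // u v uvM.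
  apply: contraT; rewrite negb_or => /andP[uM vM].
  pose K : {pred R} := fun x => v * x \in M.
  have [|J JK] := @idealr_of_closed _ K.
    split; rewrite ?unfold_in ?mulr0 ?mulr1 // => a x y; rewrite !unfold_in => xK yK.
    by rewrite mulrDr mulrCA; apply: Ml.
  case/negP: uM; apply: (Mmax J) => [x xM|]; rewrite JK unfold_in; last by rewrite mulrC.
  by rewrite -[_ * _]addr0; apply: Ml.
have chain s' : regular_seq s' -> {subset s' <= M} ->
    exists Q : nat -> prime_idealr R, prime_chain (size s') Q.
  move=> s'reg s'M; have [|Q Qc _] := @regular_seq_chain s' P s'reg; last by exists Q.
  by move=> x /s'M; rewrite PM.
exists M => //; exists d; split=> //; first by rewrite -sd; apply: chain.
- by exists s.
- by move=> s' s'reg s'M; have [Q Qc] := chain s' s'reg s'M; apply: dimR Qc.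
Qed.

End PrimeChains.

(** * Localization at a prime *)

(** The three facts on fractions that are needed; a morphism with these
    properties is the localization of R at the complement of M. *)
Record is_localization (R L : comNzRingType) (M : {pred R}) (f : R -> L) : Prop := {
  loc_fracE : forall x, exists a s, s \notin M /\ x * f s = f a;
  loc_unitE : forall s, s \notin M -> exists v, f s * v = 1;
  loc_kerE : forall a, f a = 0 -> exists2 u, u \notin M & u * a = 0 }.

Section LocEmbed.
Variables (R : comNzRingType) (M : prime_idealr R).

Definition loc_of (a : R) : localization M := loc_embed M a.

Lemma loc_of_zmod_morphism : zmod_morphism loc_of.
Proof.
move=> a b; rewrite /loc_of !piE; apply/eqP; rewrite piE.
by apply/asboolP; exists (loc_den1 M) => /=; ring.
Qed.

Lemma loc_of_monoid_morphism : monoid_morphism loc_of.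
Proof.
split=> [//|a b]; rewrite /loc_of !piE; apply/eqP; rewrite piE.
by apply/asboolP; exists (loc_den1 M) => /=; ring.
Qed.

HB.instance Definition _ :=
  GRing.isZmodMorphism.Build R (localization M) loc_of loc_of_zmod_morphism.
HB.instance Definition _ :=
  GRing.isMonoidMorphism.Build R (localization M) loc_of loc_of_monoid_morphism.

Lemma loc_of_localization : is_localization M loc_of.
Proof.
split=> [|s sM|a].
- elim/quotW=> x; exists x.1, (val x.2); split; first exact: (valP x.2).
  rewrite /loc_of piE; apply/eqP; rewrite piE.
  by apply/asboolP; exists (loc_den1 M) => /=; ring.
- pose d : loc_den M := exist _ s sM.
  exists (\pi_(localization M) (1, d)); rewrite /loc_of piE; apply/eqP; rewrite piE.
  by apply/asboolP; exists (loc_den1 M) => /=; ring.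
- move=> /eqP; rewrite /loc_of piE => /asboolP[[u uM]] /=.
  by rewrite mulr1 mul0r subr0; exists u.
Qed.

End LocEmbed.

Section LocTheory.
Variables (R L : comNzRingType) (M : prime_idealr R) (f : {rmorphism R -> L}).
Hypothesis locf : is_localization M f.

Lemma loc_eq a b : f a = f b -> exists2 u, u \notin M & u * a = u * b.
Proof.
move=> /eqP; rewrite -subr_eq0 -rmorphB => /eqP /(loc_kerE locf)[u uM].
by move=> /eqP; rewrite mulrBr subr_eq0 => /eqP; exists u.
Qed.

Lemma loc_denM_notin a b : a \notin M -> b \notin M -> a * b \notin M.
Proof. by move=> aM bM; rewrite prime_idealrM negb_or aM. Qed.

Lemma loc_mem_ideal (I : {pred L}) x a s : is_ideal I -> s \notin M ->
  x * f s = f a -> (x \in I) = (f a \in I).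
Proof.
move=> idI sM xs; apply/idP/idP => h; first by rewrite -xs mulrC is_idealM.
have [v sv] := loc_unitE locf sM.
by rewrite -[x]mulr1 -sv mulrA xs mulrC is_idealM.
Qed.

Lemma noetherian_localization : noetherian R -> noetherian L.
Proof.
move=> /noetherianP nR; apply/noetherianP => I idI.
have [s Is] := nR _ (is_ideal_preim f idI); exists (map f s) => x.
have [a [d [dM xd]]] := loc_fracE locf x.
have idg := ideal_gen_ideal (map f s).
rewrite (loc_mem_ideal idI dM xd) (loc_mem_ideal idg dM xd).
have -> : (f a \in I) = (a \in ideal_gen s) by rewrite -Is unfold_in.
apply/idP/idP; first exact: ideal_gen_image.
move=> h; rewrite -Is unfold_in; move: (f a) h; apply: ideal_gen_min => // _ /mapP[y ys ->].
by have := mem_ideal_gen ys; rewrite -Is unfold_in.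
Qed.

Definition loc_max : {pred L} :=
  fun x => asbool (exists a s, [/\ a \in M, s \notin M & x * f s = f a]).

Lemma mem_loc_max a : (f a \in loc_max) = (a \in M).
Proof.
apply/asboolP/idP => [[b [s [bM sM]]]|aM]; last first.
  by exists a, 1; rewrite idealr1 rmorph1 mulr1.
rewrite -rmorphM => /loc_eq[u uM uE].
have : u * (a * s) \in M by rewrite uE idealMr.
by rewrite !prime_idealrM (negPf uM) (negPf sM) orbF.
Qed.

Lemma loc_max_unit x : x \notin loc_max -> exists y, x * y = 1.
Proof.
have [a [s [sM xs]]] := loc_fracE locf x => xN.
have aM : a \notin M by apply: contra xN => aM; apply/asboolP; exists a, s.
by have [v av] := loc_unitE locf aM; exists (f s * v); rewrite mulrA xs.
Qed.

Lemma loc_max_closed : idealr_closed loc_max.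
Proof.
split; first by rewrite -(rmorph0 f) mem_loc_max idealr0.
  by rewrite -(rmorph1 f) mem_loc_max idealr1.
move=> z x y /asboolP[a [s [aM sM xs]]] /asboolP[b [t [bM tM yt]]]; apply/asboolP.
have [d [r [rM zr]]] := loc_fracE locf z.
exists (d * a * t + b * r * s), (r * s * t); split.
- rewrite rpredD //; first by rewrite mulrAC idealMr.
  by rewrite mulrAC mulrC idealMr // mulrC idealMr.
- by rewrite !loc_denM_notin.
- rewrite rmorphD !rmorphM -xs -yt -zr; ring.
Qed.

Lemma loc_max_local : local_max loc_max.
Proof.
have unitN (J : {pred L}) : is_ideal J -> 1 \notin J -> {subset J <= loc_max}.
  move=> idJ J1 x xJ; apply: contraT => /loc_max_unit[y xy].
  by case/negP: J1; rewrite -xy mulrC is_idealM.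
have maxN : maximal_ideal loc_max.
  split=> [|J _]; first exact: loc_max_closed.
  by apply: unitN; [exact: idealrP | rewrite idealr1].
split=> // N [[N0 N1 Nl] Nmax] x.
have [J JE] := idealr_of_closed loc_max_closed.
apply/idP/idP => [|xM]; first by apply: unitN.
by apply: (Nmax J) => [y yN|]; rewrite JE //; apply: unitN yN.
Qed.

Lemma loc_ideal_gen s a : f a \in ideal_gen (map f s) ->
  exists2 u, u \notin M & u * a \in ideal_gen s.
Proof.
have [g0 gl] := ideal_gen_ideal s.
pose K : {pred L} := fun x => asbool (exists b d,
  [/\ b \in ideal_gen s, d \notin M & x * f d = f b]).
suff: {subset ideal_gen (map f s) <= K}.
  move=> h /h/asboolP[b [d [bs dM]]]; rewrite -rmorphM => /loc_eq[u uM uE].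
  exists (u * d); first exact: loc_denM_notin.
  by rewrite -mulrA [d * a]mulrC uE is_idealM //; apply: ideal_gen_ideal.
apply: ideal_gen_min => [|_ /mapP[b bs ->]]; last first.
  by apply/asboolP; exists b, 1; rewrite mem_ideal_gen // idealr1 rmorph1 mulr1.
split=> [|z x y /asboolP[b [d [bs dM xd]]] /asboolP[c [e [cs eM ye]]]]; apply/asboolP.
  by exists 0, 1; rewrite idealr1 mul0r rmorph0.
have [w [r [rM zr]]] := loc_fracE locf z.
exists ((w * e) * b + (r * d) * c), (r * d * e); split.
- by apply: gl => //; apply: is_idealM => //; apply: ideal_gen_ideal.
- by rewrite !loc_denM_notin.
- rewrite rmorphD !rmorphM -xd -ye -zr; ring.
Qed.

Lemma regular_seq_localization s : regular_seq s -> {subset s <= M} ->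
  regular_seq (map f s) /\ {subset map f s <= loc_max}.
Proof.
move=> [sreg _] sM.
have sN : {subset map f s <= loc_max} by move=> _ /mapP[x xs ->]; rewrite mem_loc_max sM.
split=> //; split=> [i|]; last first.
  have [N0 /negP N1 Nl] := loc_max_closed; apply/negP => h; apply: N1.
  by move: h; apply: ideal_gen_min.
rewrite size_map => si x; rewrite (nth_map 0) // -map_take => h.
have [a [d [dM xd]]] := loc_fracE locf x.
have idg := ideal_gen_ideal (map f (take i s)).
rewrite (loc_mem_ideal idg dM xd).
have : f (s`_i * a) \in ideal_gen (map f (take i s)).
  by rewrite rmorphM -xd mulrA mulrC is_idealM.
case/loc_ideal_gen=> u uM; rewrite mulrCA => /(sreg _ si) uas.
have [v uv] := loc_unitE locf uM.
by rewrite -[f a]mul1r -uv [f u * v]mulrC -mulrA -rmorphM is_idealM // ideal_gen_image.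
Qed.

End LocTheory.

(** * Algebraic dependence bounds chains of primes *)

(** Exponent vectors of length d with entries below N, nested so that the
    first variable splits off definitionally. *)
Fixpoint box (N d : nat) : finType :=
  if d is d'.+1 then ('I_N * box N d')%type else unit.

Fixpoint box_mon (R : comNzRingType) (N d : nat) : (nat -> R) -> box N d -> R :=
  match d with
  | 0 => fun _ _ => 1
  | d'.+1 => fun x b => x 0%N ^+ b.1 * box_mon (fun i => x i.+1) b.2
  end.

Lemma card_box N d : #|box N d| = (N ^ d)%N.
Proof. by elim: d => [|d IHd] /=; rewrite ?card_unit // card_prod card_ord IHd expnS. Qed.

Lemma sum_pairE (R : nmodType) (I J : finType) (G : I * J -> R) :
  \sum_p G p = \sum_i \sum_j G (i, j).
Proof. by rewrite pair_bigA; apply: eq_bigr => -[]. Qed.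

Lemma rmorph_box_mon (R S : comNzRingType) (f : {rmorphism R -> S}) N d x (b : box N d) :
  f (box_mon x b) = box_mon (fun i => f (x i)) b.
Proof.
elim: d x b => [|d IHd] x b /=; first by rewrite rmorph1.
by rewrite rmorphM rmorphXn IHd.
Qed.

(** Along a chain of primes, elements picked in the successive gaps are
    algebraically independent even modulo the smallest prime. In a relation
    modulo P 0, divide by the smallest power of x 0 that occurs, which is
    legitimate as x 0 lies outside P 0, and then reduce modulo P 1, which
    contains x 0: this leaves a relation between the other elements. *)
Lemma prime_chain_independent (k : fieldType) (R : comNzRingType)
    (c : {rmorphism k -> R}) N d (F : box N d -> k) (P : nat -> prime_idealr R) x :
  prime_chain d P -> (forall i, (i < d)%N -> x i \in P i.+1 /\ x i \notin P i) ->
  (exists b, F b != 0) -> \sum_b c (F b) * box_mon x b \notin P 0%N.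
Proof.
elim: d F P x => [|d IHd] F P x Pchain xP [b0 Fb0].
  rewrite (big_pred1 tt) /=; last by case.
  have {}Fb0 : F tt != 0 by case: b0 Fb0.
  rewrite mulr1; apply/negP => h; have := idealMr (c (F tt)^-1) h.
  by rewrite -rmorphM mulVf // rmorph1 idealr1.
pose V i := \sum_b c (F (i, b)) * box_mon (fun i => x i.+1) b.
have -> : \sum_b c (F b) * box_mon x b = \sum_(i < N) x 0%N ^+ i * V i.
  transitivity (\sum_(i < N) \sum_b c (F (i, b)) * box_mon x ((i, b) : box N d.+1)).
    exact: sum_pairE.
  by apply: eq_bigr => i _; rewrite mulr_sumr; apply: eq_bigr => b _ /=; rewrite mulrCA.
pose nz i := [exists b, F (i, b) != 0].
have nzi0 : nz b0.1 by apply/existsP; exists b0.2; case: b0 Fb0.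
case: (arg_minnP (fun i : 'I_N => i : nat) nzi0) => i /existsP nzi imin.
have ViP : V i \notin P 1%N.
  apply: (IHd (fun b => F (i, b)) (fun i => P i.+1)) => // j jd; first exact: Pchain.
  exact: xP.
have [x0P1 x0P0] := xP 0%N isT; have [P01 _] := Pchain 0%N isT.
have [W ->] : exists W, \sum_(j < N) x 0%N ^+ j * V j = x 0%N ^+ i * (V i + x 0%N * W).
  exists (\sum_(j < N | (i < j)%N) x 0%N ^+ (j - i.+1) * V j).
  rewrite (bigID (fun j : 'I_N => (i < j)%N)) /= addrC (bigD1 i) ?ltnn //= big1 ?addr0.
    rewrite mulrDr; congr (_ + _); rewrite [RHS]mulrA -exprSr mulr_sumr.
    by apply: eq_bigr => j ij; rewrite mulrA -exprD subnKC.
  move=> j; rewrite -leqNgt => /andP[ji jni]; rewrite /V big1 ?mulr0 // => b _.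
  have [->|Fjb] := eqVneq (F (j, b)) 0; first by rewrite rmorph0 mul0r.
  have /imin ij : nz j by apply/existsP; exists b.
  by case/eqP: jni; apply/val_inj/eqP; rewrite eqn_leq ji.
rewrite prime_idealrM negb_or; apply/andP; split.
  by elim: (val i) => [|j IHj]; rewrite ?idealr1 // exprS prime_idealrM negb_or x0P0.
apply: contra ViP => /P01; rewrite [x 0%N * W]mulrC => h.
by rewrite -[V i](addrK (W * x 0%N)) rpredB // idealMr.
Qed.

Lemma linear_dependence (k : fieldType) (I J : finType) (A : I -> J -> k) :
  (#|J| < #|I|)%N ->
  exists2 F : I -> k, exists i, F i != 0 & forall j, \sum_i F i * A i j = 0.
Proof.
move=> JI; pose B := \matrix_(i < #|I|, j < #|J|) A (enum_val i) (enum_val j).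
have /matrix0Pn[u [v uv]] : kermx B != 0.
  rewrite -mxrank_eq0 mxrank_ker subn_eq0 -ltnNge.
  exact: leq_ltn_trans (rank_leq_col _) JI.
move: (kermx B) (mulmx_ker B) uv => K KB uv.
exists (fun i => K u (enum_rank i)); first by exists (enum_val v); rewrite enum_valK.
move=> j; have /matrixP/(_ u (enum_rank j)) := KB; rewrite !mxE => KBj.
apply: etrans KBj; rewrite (reindex (fun i : 'I_#|I| => enum_val i)) /=.
  by apply: eq_bigr => i _; rewrite enum_valK mxE enum_rankK.
by apply: onW_bij; exists enum_rank => i; rewrite ?enum_valK ?enum_rankK.
Qed.

Section Dependence.
Variables (k : fieldType) (n : nat).

Let deg_le (p : {mpoly k[n]}) e := forall m, m \in msupp p -> (mdeg m <= e)%N.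

Let deg_leM p q e1 e2 : deg_le p e1 -> deg_le q e2 -> deg_le (p * q) (e1 + e2).
Proof.
move=> pe qe m /msuppM_le /allpairsP[[m1 m2] /= [/pe le1 /qe le2 ->]].
by rewrite mdegD leq_add.
Qed.

Let deg_le_box N d D (p : nat -> {mpoly k[n]}) (b : box N d) :
  (forall i, (i < d)%N -> deg_le (p i) D) -> deg_le (box_mon p b) (d * (N * D)).
Proof.
elim: d p b => [|d IHd] p b pD /=.
  by move=> m; rewrite msupp1 inE => /eqP ->; rewrite mdeg0.
rewrite mulSn; apply: deg_leM; last by apply: IHd => i id; apply: pD.
have : deg_le (p 0%N ^+ b.1) (b.1 * D).
  elim: (val b.1) => [|e IHe].
    by move=> m; rewrite expr0 msupp1 inE => /eqP ->; rewrite mdeg0.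
  by rewrite exprS mulSn; apply: deg_leM => //; apply: pD.
by move=> h m /h /leq_trans; apply; rewrite leq_mul2r ltnW ?orbT // ltn_ord.
Qed.

(** More than n polynomials in n variables are algebraically dependent: the
    N ^ d monomials in d > n of them are combinations of at most (C * N) ^ n
    monomials in the variables. *)
Lemma mpoly_dependent (p : nat -> {mpoly k[n]}) : exists N (F : box N n.+1 -> k),
  (exists b, F b != 0) /\ \sum_b F b *: box_mon p b = 0.
Proof.
have [D pD] : exists D, forall i, (i < n.+1)%N -> deg_le (p i) D.
  exists (\max_(i < n.+1) msize (p i)) => i id m mp.
  apply: leq_trans (ltnW (msize_mdeg_lt mp)) _.
  exact: (leq_bigmax (Ordinal id)).
pose C := (n.+1 * D).+1; pose N := (C ^ n).+1; pose E := (n.+1 * (N * D)).+1.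
have [|F nzF F0] := @linear_dependence k (box N n.+1) {ffun 'I_n -> 'I_E}
    (fun b j => (box_mon p b)@_[multinom (j i : nat) | i < n]).
  rewrite card_box card_ffun !card_ord.
  have le_exp a b e : (a <= b)%N -> (a ^ e <= b ^ e)%N by case: e => // e; rewrite leq_exp2r.
  have EC : (E <= C * N)%N by rewrite /E /C; nia.
  apply: leq_ltn_trans (le_exp _ _ n EC) _.
  by rewrite expnMn expnS ltn_pmul2r ?expn_gt0.
exists N, F; split=> //; apply/mpolyP => m; rewrite raddf_sum mcoeff0 /=.
have [mE|mE] := leqP (mdeg m) (n.+1 * (N * D)); last first.
  apply: big1 => b _; rewrite mcoeffZ memN_msupp_eq0 ?mulr0 //.
  by apply/negP => /(deg_le_box pD); rewrite leqNgt mE.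
have mi i : (m i < E)%N.
  by rewrite ltnS (leq_trans _ mE) // mdegE (bigD1 i) //= leq_addr.
rewrite -[RHS](F0 [ffun i => Ordinal (mi i)]); apply: eq_bigr => b _.
rewrite mcoeffZ; congr (_ * _@__); apply/mnmP => i.
by rewrite mnmE ffunE.
Qed.

End Dependence.

Lemma localization_chain_leq (k : fieldType) n (R L : comNzRingType)
    (v : {rmorphism R -> {mpoly k[n]}}) (c : {rmorphism k -> R})
    (M : prime_idealr R) (f : {rmorphism R -> L}) m (P : nat -> prime_idealr L) :
  injective v -> (forall a, v (c a) = a%:MP) -> is_localization M f ->
  prime_chain m P -> (m <= n)%N.
Proof.
move=> vI vc locf Pchain; rewrite leqNgt; apply/negP => nm.
have /choice[a aP] : forall i, exists a, (i < n.+1)%N -> f a \in P i.+1 /\ f a \notin P i.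
  move=> i; have [ni|//] := ltnP i n.+1; last by exists 0.
  have [_ nsub] := Pchain i (leq_trans ni nm).
  have [x [xP xnP]] : exists x, x \in P i.+1 /\ x \notin P i.
    apply: contrapT => h; apply: nsub => x xP; apply: contraT => xnP.
    by case: h; exists x.
  have [a [s [sM xs]]] := loc_fracE locf x; exists a => _.
  by rewrite -!(loc_mem_ideal locf (idealrP _) sM xs).
have [N [F [nzF]]] := mpoly_dependent (fun i => v (a i)).
have Pc : prime_chain n.+1 P by move=> i ni; apply: Pchain; apply: leq_trans ni nm.
move=> F0; have := prime_chain_independent (f \o c) Pc aP nzF.
suff -> : \sum_b (f \o c) (F b) * box_mon (fun i => f (a i)) b = 0 by rewrite idealr0.
have : \sum_b c (F b) * box_mon a b = 0.
  apply: vI; rewrite raddf_sum raddf0 /= -[RHS]F0; apply: eq_bigr => b _.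
  by rewrite rmorphM vc mul_mpolyC; congr (_ *: _); apply: (@rmorph_box_mon _ _ v N n.+1 a).
move=> /(congr1 f); rewrite raddf_sum raddf0 /= => S0; rewrite -[RHS]S0.
by apply: eq_bigr => b _; rewrite rmorphM; congr (_ * _); rewrite (@rmorph_box_mon _ _ f N n.+1 a).
Qed.

(** * Hilbert's Nullstellensatz *)

Section SubringAdjunction.
Variable K : fieldType.
Implicit Types (D : subringClosed K) (y : K).

Lemma subring_of_closed (S : {pred K}) : subring_closed S ->
  exists D : subringClosed K, D =i S.
Proof.
move=> cS; exists (HB.pack_for (subringClosed K) (S : K -> bool)
  (GRing.isSubringClosed.Build K S cS)).
by [].
Qed.

Definition adjoin D y : {pred K} :=
  fun x => asbool (exists2 p, p \is a polyOver D & x = p.[y]).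

Lemma adjoin_subring D y : subring_closed (adjoin D y).
Proof.
split=> [|_ _ /asboolP[p pD ->] /asboolP[q qD ->]|_ _ /asboolP[p pD ->] /asboolP[q qD ->]];
  apply/asboolP.
- by exists 1; rewrite ?rpred1 ?hornerC.
- by exists (p - q); rewrite ?rpredB // !hornerE.
- by exists (p * q); rewrite ?rpredM // hornerM.
Qed.

HB.instance Definition _ D y :=
  GRing.isSubringClosed.Build K (adjoin D y) (adjoin_subring D y).

Lemma sub_adjoin D y : {subset D <= adjoin D y}.
Proof. by move=> a aD; apply/asboolP; exists a%:P; rewrite ?polyOverC ?hornerC. Qed.

Lemma mem_adjoin D y : y \in adjoin D y.
Proof. by apply/asboolP; exists 'X; rewrite ?polyOverX ?hornerX. Qed.

Definition algebraic_in D y : Prop :=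
  exists p, [/\ p \is a polyOver D, p != 0 & p.[y] = 0].

(** Inverting the single element e turns D into a field; such a D is known as
    a Goldman domain. *)
Definition almost_field D : Prop := exists2 e, (e \in D) && (e != 0) &
  forall d, d \in D -> d != 0 -> exists N, exists2 b, b \in D & d * b = e ^+ N.

Lemma pseudo_division D (p q : {poly K}) :
  p \is a polyOver D -> q \is a polyOver D -> p != 0 ->
  exists j h r, [/\ h \is a polyOver D, r \is a polyOver D,
    lead_coef p ^+ j *: q = h * p + r & (size r < size p)%N].
Proof.
move=> pD qD p0; have lD : lead_coef p \in D by rewrite lead_coefE (polyOverP pD).
move: {2}(size q) (leqnn (size q)) => n; elim: n q qD => [|n IHn] q qD sq.
  exists 0%N, 0, q; rewrite rpred0 scale1r mul0r add0r; split=> //.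
  by rewrite (leq_ltn_trans sq) // size_poly_gt0.
have [ltqp|lepq] := ltnP (size q) (size p).
  by exists 0%N, 0, q; rewrite rpred0 scale1r mul0r add0r.
pose m := lead_coef q *: 'X^(size q - size p).
have mD : m \is a polyOver D.
  by rewrite polyOverZ ?polyOverXn // lead_coefE (polyOverP qD).
pose q1 := lead_coef p *: q - m * p.
have q1D : q1 \is a polyOver D by rewrite rpredB ?rpredM // polyOverZ.
have [|j [h [r [hD rD E sr]]]] := IHn q1 q1D.
  apply/leq_sizeP => i ni; rewrite coefB coefZ -scalerAl coefZ coefXnM.
  have p1 : (0 < size p)%N by rewrite size_poly_gt0.
  have [iq|iq] := eqVneq i (size q).-1.
    rewrite ifF; last by apply/negbTE; rewrite -leqNgt iq; lia.
    have -> : (i - (size q - size p))%N = (size p).-1 by rewrite iq; lia.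
    by rewrite iq -!lead_coefE mulrC subrr.
  have {}iq : (size q <= i)%N by move/eqP: iq; lia.
  rewrite [q`_i]nth_default ?mulr0 ?sub0r //.
  case: ifP => _; rewrite ?mulr0 ?oppr0 // nth_default ?mulr0 ?oppr0 //.
  by rewrite -{1}(subKn lepq) leq_sub2r.
exists j.+1, (h + lead_coef p ^+ j *: m), r; split=> //.
  by rewrite rpredD // polyOverZ // rpredX.
rewrite exprSr -scalerA -[lead_coef p *: q](subrK (m * p)) -/q1 scalerDr E.
by rewrite mulrDl addrAC scalerAl.
Qed.

(** If y were transcendental then 1 + e * y, which is prime to e, could not
    divide a power of e. Indeed, if it does then it has an inverse s.[y] in D[y],
    and this is a nontrivial relation for y. *)
Lemma almost_field_algebraic D y : almost_field (adjoin D y) -> algebraic_in D y.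
Proof.
case=> e /andP[/asboolP[g gD eE] e0] eU.
have g0 : g != 0 by apply: contraNneq e0 => g0; rewrite eE g0 horner0.
pose w := 1 + g * 'X.
have wD : w \is a polyOver D by rewrite rpredD ?rpred1 // rpredM ?polyOverX.
have wy : w.[y] = 1 + e * y by rewrite !hornerE eE.
have sw : (1 < size w)%N.
  by rewrite /w addrC size_MXaddC (negPf g0) /= ltnS size_poly_gt0.
have [wy0|wy0] := eqVneq w.[y] 0.
  by exists w; split=> //; rewrite -size_poly_gt0 ltnW.
have wA : w.[y] \in adjoin D y by apply/asboolP; exists w.
have [N [_ /asboolP[h hD ->] E]] := eU _ wA wy0.
pose s := \sum_(i < N) (- (g * 'X)) ^+ i + (- 'X) ^+ N * h.
have sD : s \is a polyOver D.
  by rewrite rpredD ?rpred_sum ?rpredM ?rpredX ?rpredN ?polyOverX // => i _;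
    rewrite rpredX ?rpredN ?rpredM ?polyOverX.
exists (w * s - 1); split; first by rewrite rpredB ?rpred1 ?rpredM.
  rewrite subr_eq0; apply: contraTneq sw => ws1.
  by have := size_mul_eq1 w s; rewrite ws1 size_poly1 eqxx => /esym/andP[/eqP -> _].
have geo : w * (\sum_(i < N) (- (g * 'X)) ^+ i) = 1 - (- (g * 'X)) ^+ N.
  by have /(congr1 -%R) := subrX1 (- (g * 'X)) N; rewrite opprB -mulNr opprB opprK => ->.
have -> : w * s - 1 = (- 'X) ^+ N * (w * h - g ^+ N).
  rewrite /s mulrDr geo -mulrN exprMn; ring.
by rewrite hornerM hornerD hornerN hornerM !horner_exp E eE subrr mulr0.
Qed.

(** A relation of minimal degree m for y makes 1, y, ..., y ^+ (m - 1)
    independent over D. Comparing constant coefficients then moves a relation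
    d * b = d0 ^+ N with b in D[y] down to D, at the cost of powers of the
    leading coefficient of the minimal relation. *)
Lemma almost_field_descent D y : almost_field (adjoin D y) -> almost_field D.
Proof.
move=> AF; have [e /andP[/asboolP[g gD eE] e0] eU] := AF.
pose rel n := asbool (exists p, [/\ p \is a polyOver D, p != 0, p.[y] = 0 & size p = n]).
have ex_rel : exists n, rel n.
  have [p [pD p0 py]] := almost_field_algebraic AF.
  by exists (size p); apply/asboolP; exists p.
case: (ex_minnP ex_rel) => _ /asboolP[p [pD p0 py <-]] pmin {ex_rel}.
have small q : q \is a polyOver D -> q.[y] = 0 -> (size q < size p)%N -> q = 0.
  move=> qD qy sq; apply/eqP; apply: contraTT sq => q0; rewrite -leqNgt.
  by apply: pmin; apply/asboolP; exists q.
have lD : lead_coef p \in D by rewrite lead_coefE (polyOverP pD).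
have l0 : lead_coef p != 0 by rewrite lead_coef_eq0.
have adjD q : q \is a polyOver D -> q.[y] \in adjoin D y by move=> qD; apply/asboolP; exists q.
(* Euclid's algorithm for g and p, which are coprime since p is minimal. *)
have [d0 [d0D d00 [b bD eb]]] : exists d0, [/\ d0 \in D, d0 != 0 &
    exists2 b, b \is a polyOver D & e * b.[y] = d0].
  pose mul n := asbool (exists q, [/\ q \is a polyOver D, q.[y] != 0, size q = n &
    exists2 b, b \is a polyOver D & e * b.[y] = q.[y]]).
  have ex_mul : exists n, mul n.
    exists (size g); apply/asboolP; exists g; split; rewrite -?eE //.
    by exists 1; rewrite ?rpred1 // hornerC mulr1.
  case: (ex_minnP ex_mul) => _ /asboolP[q [qD qy <- [b bD eb]]] qmin {ex_mul}.
  have q0 : q != 0 by apply: contraNneq qy => ->; rewrite horner0.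
  have minmul r c : r \is a polyOver D -> c \is a polyOver D -> e * c.[y] = r.[y] ->
      (size r < size q)%N -> r.[y] = 0.
    move=> rD cD E sr; apply/eqP; apply: contraTT sr => ry; rewrite -leqNgt.
    by apply: qmin; apply/asboolP; exists r; split=> //; exists c.
  have sqp : (size q < size p)%N.
    have [j [h [r [hD rD E sr]]]] := pseudo_division pD qD p0.
    have ry : r.[y] = lead_coef p ^+ j * q.[y].
      by rewrite -hornerZ E hornerD hornerM py mulr0 add0r.
    apply: leq_ltn_trans sr; rewrite leqNgt; apply/negP => srq.
    have /eqP : r.[y] = 0.
      apply: (minmul r (lead_coef p ^+ j *: b)) => //.
        by rewrite polyOverZ // rpredX.
      by rewrite hornerZ mulrCA eb.
    by rewrite ry mulf_eq0 (negPf qy) orbF expf_eq0 (negPf l0) andbF.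
  have [j [h [r [hD rD E sr]]]] := pseudo_division qD pD q0.
  have r0 : r = 0.
    apply: small (rD) _ (ltn_trans sr sqp).
    apply: (minmul r (- h * b)); rewrite ?rpredM ?rpredN //.
    have := congr1 (fun q => q.[y]) E.
    rewrite hornerZ py mulr0 hornerD !hornerM hornerN => /esym/eqP.
    by rewrite addrC addr_eq0 => /eqP ->; rewrite mulrCA eb mulNr.
  have lq0 : lead_coef q ^+ j != 0 by rewrite expf_neq0 // lead_coef_eq0.
  have h0 : h != 0.
    apply: contraNneq p0 => h0; move: E; rewrite h0 r0 mul0r addr0 => /eqP.
    by rewrite scaler_eq0 (negPf lq0).
  have hy : h.[y] = 0.
    have := congr1 (fun q => q.[y]) E; rewrite r0 addr0 hornerZ py mulr0 hornerM.
    by move=> /esym/eqP; rewrite mulf_eq0 (negPf qy) orbF => /eqP.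
  have sph : (size p <= size h)%N by apply: pmin; apply/asboolP; exists h.
  have sq1 : (size q <= 1)%N.
    have := congr1 (fun q : {poly K} => size q) E.
    rewrite /= r0 addr0 size_scale // size_mul // => sE.
    by move: sph; rewrite sE -subn1 leq_subLR [(size h + _)%N]addnC leq_add2r.
  exists q.[y]; split=> //; last by exists b.
  by rewrite (size1_polyC sq1) hornerC (polyOverP qD).
exists (lead_coef p * d0); first by rewrite rpredM // mulf_neq0.
move=> d dD d_neq0; have [N [_ /asboolP[h hD ->] E]] := eU d (sub_adjoin y dD) d_neq0.
have [|j [h' [r [h'D rD E' sr]]]] := @pseudo_division D p (h * b ^+ N) pD _ p0.
  by rewrite rpredM ?rpredX.
have ry : d * r.[y] = lead_coef p ^+ j * d0 ^+ N.
  have := congr1 (fun q => q.[y]) E'; rewrite hornerD !(hornerZ, hornerM) py mulr0 add0r => <-.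
  by rewrite horner_exp mulrCA [d * _]mulrA E -exprMn eb.
have dr : d *: r - (lead_coef p ^+ j * d0 ^+ N)%:P = 0.
  apply: small.
  - by rewrite rpredB ?polyOverZ // polyOverC rpredM ?rpredX.
  - by rewrite hornerD hornerN hornerZ hornerC ry subrr.
  - rewrite (leq_ltn_trans (size_polyD _ _)) // gtn_max (leq_ltn_trans (size_scale_leq _ _)) //=.
    rewrite size_polyN (leq_ltn_trans (size_polyC_leq1 _)) //.
    apply: contraTT isT; rewrite -leqNgt => /size1_polyC pC.
    by move: py p0; rewrite pC hornerC => ->; rewrite eqxx.
exists (N + j)%N, (r`_0 * (lead_coef p ^+ N * d0 ^+ j)).
  by rewrite !rpredM ?rpredX // (polyOverP rD).
have := congr1 (fun q : {poly K} => q`_0) dr.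
rewrite coefB coefZ coefC coef0 eqxx => /eqP; rewrite subr_eq0 => /eqP dr0.
by rewrite [LHS]mulrA dr0 exprMn !exprD; ring.
Qed.

End SubringAdjunction.

(** Descent along the tower of simple extensions from K, a field, to D. *)
Lemma almost_field_generated (K : fieldType) (D : subringClosed K) (s : seq K) :
  (forall E : subringClosed K, {subset D <= E} -> {subset s <= E} -> forall x, x \in E) ->
  almost_field D.
Proof.
elim: s D => [|y s IHs] D full.
  exists 1; first by rewrite rpred1 oner_neq0.
  move=> d dD d0; exists 0%N, d^-1; last by rewrite mulfV.
  exact: full.
apply: (@almost_field_descent _ _ y); apply: IHs => E DE sE.
apply: full => [a /(sub_adjoin y)/DE //|x]; rewrite in_cons => /orP[/eqP ->|/sE //].
by apply: DE; apply: mem_adjoin.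
Qed.

(** Adjoining x first, descent down to k shows that x is algebraic over k. *)
Theorem nullstellensatz (k : closedFieldType) (K : fieldType)
    (c : {rmorphism k -> K}) s :
  generated_by c s -> forall x, exists a, x = c a.
Proof.
move=> gs x; pose D0 : {pred K} := fun x => asbool (exists a, c a = x).
have [|D DE] := @subring_of_closed K D0.
  split=> [|_ _ /asboolP[a <-] /asboolP[b <-]|_ _ /asboolP[a <-] /asboolP[b <-]]; apply/asboolP.
  - by exists 1; rewrite rmorph1.
  - by exists (a - b); rewrite rmorphB.
  - by exists (a * b); rewrite rmorphM.
have [|p [pD p0 px]] := @almost_field_algebraic K D x.
  apply: (@almost_field_generated _ _ s) => E DxE sE; apply: gs => // [|a].
    by split=> [|u v uE vE|u v uE vE]; rewrite ?rpred1 ?rpredB ?rpredM.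
  by apply/DxE/sub_adjoin; rewrite DE; apply/asboolP; exists a.
have /choice[u uP] : forall i, exists a, c a = p`_i.
  by move=> i; apply/asboolP; have := polyOverP pD i; rewrite DE.
have [q pq] : exists q, p = map_poly c q.
  exists (\poly_(i < size p) u i); apply/polyP => i; rewrite coef_map coef_poly /=.
  by case: ltnP => [_|sp]; rewrite ?uP // rmorph0 nth_default.
have q0 : q != 0 by apply: contraNneq p0 => q0; rewrite pq q0 map_poly0.
have [r qE] := closed_field_poly_normal q.
have : root (map_poly c q) x by rewrite -pq; apply/eqP.
rewrite qE map_polyZ rootZ; last by rewrite fmorph_eq0 lead_coef_eq0.
rewrite map_prod_XsubC -(big_map c xpredT (fun b => 'X - b%:P)) root_prod_XsubC.
by case/mapP=> a _ ->; exists a.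
Qed.

Lemma field_of_inverses (A : comNzRingType) : (forall x : A, x != 0 -> exists y, y * x = 1) ->
  exists (K : fieldType) (g : {rmorphism A -> K}), bijective g.
Proof.
move=> hinv; have /choice[inv invP] : forall x : A, exists y,
    (x != 0 -> y * x = 1) /\ (x = 0 -> y = 0).
  move=> x; have [x0|/hinv[y yx]] := eqVneq x 0; first by exists 0.
  by exists y; split=> // x0; move: yx; rewrite x0 mulr0 => /esym/eqP; rewrite oner_eq0.
have mulVx x : x != 0 -> inv x * x = 1 := (invP x).1.
have inv0 : inv 0 = 0 := (invP 0).2 erefl.
pose K : fieldType := HB.pack_for fieldType A (GRing.ComNzRing_isField.Build A mulVx inv0).
by exists K, (idfun : {rmorphism A -> A}); exists id.
Qed.

Lemma residue_field (R : comNzRingType) (M : prime_idealr R) : maximal_ideal M ->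
  exists (K : fieldType) (f : {rmorphism R -> K}),
    (forall y, exists x, f x = y) /\ forall x, (f x == 0) = (x \in M).
Proof.
move=> [_ maxM]; pose Q : comNzRingType := {ideal_quot M}.
pose h : {rmorphism R -> Q} := \pi_{ideal_quot M}.
have hM x : (h x == 0) = (x \in M).
  by rewrite -[x in RHS]subr0 Quotient.idealrBE -(rmorph0 h).
have hs y : exists x, h x = y by exists (repr y); apply: reprK.
have [|K [g gbij]] := @field_of_inverses Q.
  move=> y; have [x <-] := hs y => hx0; apply: contrapT => ninv.
  pose J : {pred R} := fun u => asbool (exists2 m, m \in M & exists a, u = m + a * x).
  have MJ : {subset M <= J}.
    by move=> m mM; apply/asboolP; exists m => //; exists 0; rewrite mul0r addr0.
  have [|I IJ] := @idealr_of_closed _ J.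
    split; first by apply: MJ; apply: idealr0.
      apply/asboolP => -[m mM [a E]]; apply: ninv; exists (h a).
      rewrite -rmorphM -(rmorph1 h) E rmorphD.
      have /eqP -> : h m == 0 by rewrite hM.
      by rewrite add0r.
    move=> b _ _ /asboolP[m mM [a ->]] /asboolP[n nM [c ->]]; apply/asboolP.
    exists (b * m + n); first by rewrite rpredD // idealMr.
    by exists (b * a + c); ring.
  case/negP: hx0; rewrite hM; apply: (maxM I) => [m /MJ|]; rewrite IJ //.
  by apply/asboolP; exists 0; [apply: idealr0 | exists 1; rewrite add0r mul1r].
exists K, (g \o h); split=> [y|x] /=.
  have [g' _ gK] := gbij; have [x xE] := hs (g' y).
  by exists x; rewrite /= xE gK.
by rewrite -hM -(inj_eq (bij_inj gbij)) rmorph0.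
Qed.

(** * The semigroups H_3t *)

Section Semigroup.
Local Open Scope nat_scope.

Lemma semigroup_gen_min (n : nat) (gs : seq 'X_{1..n}) (S : {pred 'X_{1..n}}) :
  0%MM \in S -> {in S &, forall m1 m2, (m1 + m2)%MM \in S} -> {subset gs <= S} ->
  {subset semigroup_gen gs <= S}.
Proof.
move=> S0 SD gS m /asboolP[c ->]; elim/big_ind: _ => // i _.
have gi : nth 0%MM gs i \in S by apply: gS; rewrite mem_nth.
by elim: (c i) => [|e IHe]; rewrite ?mulm0n // mulmS SD.
Qed.

Lemma mem_semigroup_gen (n : nat) (gs : seq 'X_{1..n}) : {subset gs <= semigroup_gen gs}.
Proof.
move=> m mgs; apply/asboolP; have hi : index m gs < size gs by rewrite index_mem.
exists (fun i => (i == Ordinal hi) : nat); rewrite (bigD1 (Ordinal hi)) //= eqxx mulm1n.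
by rewrite nth_index // big1 ?addm0 // => i /negPf ->; rewrite mulm0n.
Qed.

Lemma mnm3P (m m' : 'X_{1..3}) :
  m 0%R = m' 0%R -> m 1%R = m' 1%R -> m 2%R = m' 2%R -> m = m'.
Proof.
move=> e0 e1 e2; apply/mnmP => -[[|[|[|//]]] hi].
- by have -> : Ordinal hi = 0%R by apply: val_inj.
- by have -> : Ordinal hi = 1%R by apply: val_inj.
- by have -> : Ordinal hi = 2%R by apply: val_inj.
Qed.

Lemma mnm3E (m : 'X_{1..3}) : m = mnm3 (m 0%R) (m 1%R) (m 2%R).
Proof. exact: mnm3P. Qed.

Lemma mnm3D a b c a' b' c' :
  (mnm3 a b c + mnm3 a' b' c')%MM = mnm3 (a + a') (b + b') (c + c').
Proof. by apply: mnm3P; rewrite mnmDE. Qed.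

(** Unfolding the recursion: the generators are j * m + 3 * (t - j) * e_i. *)
Lemma H3_gensP t (m : 'X_{1..3}) : 0 < t -> m \in H3_gens t <->
  exists2 j, j <= t & [\/ m = mnm3 (j + 3 * (t - j)) j j,
    m = mnm3 j (j + 3 * (t - j)) j | m = mnm3 j j (j + 3 * (t - j))].
Proof.
case: t => // t _; elim: t m => [|t IHt] m.
  split=> [|[[|[|//]] _ [] ->]] //; rewrite !inE.
  move=> /or4P[] /eqP ->; [exists 0 | exists 0 | exists 0 | exists 1] => //.
  - exact: Or31.
  - exact: Or32.
  - exact: Or33.
  - exact: Or31.
have -> : H3_gens t.+2 = [:: mnm3 (3 * t.+2) 0 0, mnm3 0 (3 * t.+2) 0, mnm3 0 0 (3 * t.+2)
              & [seq (mnm3 1 1 1 + h)%MM | h <- H3_gens t.+1]] by [].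
rewrite !inE; split=> [/or4P[/eqP ->|/eqP ->|/eqP ->|/mapP[h /IHt[j jt hE] ->]]|].
- by exists 0 => //; apply: Or31.
- by exists 0 => //; apply: Or32.
- by exists 0 => //; apply: Or33.
- exists j.+1 => //; rewrite subSS.
  by case: hE => ->; rewrite mnm3D; [apply: Or31 | apply: Or32 | apply: Or33].
case=> -[|j] jt [] ->; rewrite ?eqxx ?orbT //; apply/or4P/Or44; rewrite subSS.
- apply/mapP; exists (mnm3 (j + 3 * (t.+1 - j)) j j); last by rewrite mnm3D.
  by apply/IHt; exists j => //; apply: Or31.
- apply/mapP; exists (mnm3 j (j + 3 * (t.+1 - j)) j); last by rewrite mnm3D.
  by apply/IHt; exists j => //; apply: Or32.
- apply/mapP; exists (mnm3 j j (j + 3 * (t.+1 - j))); last by rewrite mnm3D.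
  by apply/IHt; exists j => //; apply: Or33.
Qed.

Variable t : nat.
Hypothesis t_gt0 : 0 < t.
Let n := 3 * t.
Let H : {pred 'X_{1..3}} := semigroup_gen (H3_gens t).

(** A sum of d generators, with the copies of m collected in J and v split
    into c pieces of size at most t along the three axes. *)
Definition H3_sum d J v0 v1 v2 c0 c1 c2 : Prop :=
  [/\ v0 <= t * c0, v1 <= t * c1, v2 <= t * c2, c0 + c1 + c2 <= d &
      v0 + v1 + v2 + J = t * d].

Let gen0 j : j <= t -> mnm3 (j + 3 * (t - j)) j j \in H.
Proof. by move=> jt; apply/mem_semigroup_gen/H3_gensP => //; exists j => //; apply: Or31. Qed.
Let gen1 j : j <= t -> mnm3 j (j + 3 * (t - j)) j \in H.
Proof. by move=> jt; apply/mem_semigroup_gen/H3_gensP => //; exists j => //; apply: Or32. Qed.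
Let gen2 j : j <= t -> mnm3 j j (j + 3 * (t - j)) \in H.
Proof. by move=> jt; apply/mem_semigroup_gen/H3_gensP => //; exists j => //; apply: Or33. Qed.

Let split_gen g0 g1 g2 a b c : mnm3 g0 g1 g2 \in H -> g0 <= a -> g1 <= b -> g2 <= c ->
  mnm3 (a - g0) (b - g1) (c - g2) \in H -> mnm3 a b c \in H.
Proof.
move=> gH ga gb gc hH.
by rewrite -(subnKC ga) -(subnKC gb) -(subnKC gc) -mnm3D semigroup_genD.
Qed.

Lemma H3_sum10 d J v0 v1 v2 c0 c1 c2 :
  H3_sum d J v0 v1 v2 c0 c1 c2 -> H3_sum d J v1 v0 v2 c1 c0 c2.
Proof. by case=> ? ? ? ? ?; split=> //; lia. Qed.

Lemma H3_sum20 d J v0 v1 v2 c0 c1 c2 :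
  H3_sum d J v0 v1 v2 c0 c1 c2 -> H3_sum d J v2 v1 v0 c2 c1 c0.
Proof. by case=> ? ? ? ? ?; split=> //; lia. Qed.

(** Splitting off the generator that takes as much as possible of v0: there
    are enough copies of m left to complete it. *)
Lemma H3_sum_step d J v0 v1 v2 c0 c1 c2 (w := minn v0 t) :
  0 < v0 -> H3_sum d.+1 J v0 v1 v2 c0 c1 c2 ->
  t - w <= J /\ H3_sum d (J - (t - w)) (v0 - w) v1 v2 c0.-1 c1 c2.
Proof.
move=> v0_gt0 [h0 h1 h2 hc hJ]; have c0_gt0 : 0 < c0 by case: (c0) h0; lia.
have [tv0|v0t] := leqP t v0.
  have -> : w = t by rewrite /w; lia.
  rewrite subnn subn0 leq0n; split=> //; split=> //; try lia.
  by move: h0; case: (c0) c0_gt0 => // c _; rewrite mulnS /=; lia.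
have -> : w = v0 by rewrite /w; lia.
have h12 : t * (c1 + c2) <= t * d by rewrite leq_mul2l; lia.
rewrite mulnDr in h12; rewrite mulnS in hJ; rewrite subnn.
by split; [lia | split=> //; lia].
Qed.

Lemma H3_sum_mem d J v0 v1 v2 c0 c1 c2 : H3_sum d J v0 v1 v2 c0 c1 c2 ->
  mnm3 (J + 3 * v0) (J + 3 * v1) (J + 3 * v2) \in H.
Proof.
elim: d J v0 v1 v2 c0 c1 c2 => [|d IHd] J v0 v1 v2 c0 c1 c2 S.
  have [-> -> -> ->] : [/\ v0 = 0, v1 = 0, v2 = 0 & J = 0].
    by case: S => h0 h1 h2 hc; rewrite muln0 => hJ; split; lia.
  by have -> : mnm3 (0 + 3 * 0) (0 + 3 * 0) (0 + 3 * 0) = 0%MM;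
    [apply: mnm3P; rewrite mnm0E | apply: semigroup_gen0].
have [v0_gt0|v00] := ltnP 0 v0.
  have [Jw /IHd] := H3_sum_step v0_gt0 S; set w := minn v0 t => hH.
  have wv : w <= v0 := geq_minl _ _; have wt : w <= t := geq_minr _ _.
  apply: (split_gen (gen0 (leq_subr w t))); rewrite ?subKn //; try lia.
  have -> : J + 3 * v0 - (t - w + 3 * w) = J - (t - w) + 3 * (v0 - w) by lia.
  have -> : J + 3 * v1 - (t - w) = J - (t - w) + 3 * v1 by lia.
  by have -> : J + 3 * v2 - (t - w) = J - (t - w) + 3 * v2 by lia.
have [v1_gt0|v10] := ltnP 0 v1.
  have [Jw /H3_sum10/IHd] := H3_sum_step v1_gt0 (H3_sum10 S); set w := minn v1 t => hH.
  have wv : w <= v1 := geq_minl _ _; have wt : w <= t := geq_minr _ _.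
  apply: (split_gen (gen1 (leq_subr w t))); rewrite ?subKn //; try lia.
  have -> : J + 3 * v0 - (t - w) = J - (t - w) + 3 * v0 by lia.
  have -> : J + 3 * v1 - (t - w + 3 * w) = J - (t - w) + 3 * (v1 - w) by lia.
  by have -> : J + 3 * v2 - (t - w) = J - (t - w) + 3 * v2 by lia.
have [v2_gt0|v20] := ltnP 0 v2.
  have [Jw /H3_sum20/IHd] := H3_sum_step v2_gt0 (H3_sum20 S); set w := minn v2 t => hH.
  have wv : w <= v2 := geq_minl _ _; have wt : w <= t := geq_minr _ _.
  apply: (split_gen (gen2 (leq_subr w t))); rewrite ?subKn //; try lia.
  have -> : J + 3 * v0 - (t - w) = J - (t - w) + 3 * v0 by lia.
  have -> : J + 3 * v1 - (t - w) = J - (t - w) + 3 * v1 by lia.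
  by have -> : J + 3 * v2 - (t - w + 3 * w) = J - (t - w) + 3 * (v2 - w) by lia.
move: v00 v10 v20 S; rewrite !leqn0 => /eqP -> /eqP -> /eqP -> [_ _ _ hc].
rewrite mulnS => hJ; apply: (split_gen (gen0 (leqnn t))); try lia.
have -> : J + 3 * 0 - (t + 3 * (t - t)) = J - t + 3 * 0 by lia.
have -> : J + 3 * 0 - t = J - t + 3 * 0 by lia.
by apply: (IHd _ 0 0 0 0 0 0); split=> //; lia.
Qed.

Lemma mem_H3_sum (m : 'X_{1..3}) : m \in H ->
  exists d J v0 v1 v2 c0 c1 c2, H3_sum d J v0 v1 v2 c0 c1 c2 /\
    m = mnm3 (J + 3 * v0) (J + 3 * v1) (J + 3 * v2).
Proof.
pose S : {pred 'X_{1..3}} := fun m => asbool (exists d J v0 v1 v2 c0 c1 c2,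
  H3_sum d J v0 v1 v2 c0 c1 c2 /\ m = mnm3 (J + 3 * v0) (J + 3 * v1) (J + 3 * v2)).
suff HS : {subset H <= S} by move=> /HS/asboolP.
apply: semigroup_gen_min => [|x y /asboolP[d [J [v0 [v1 [v2 [c0 [c1 [c2 [S1 ->]]]]]]]]]
    /asboolP[d' [J' [v0' [v1' [v2' [c0' [c1' [c2' [S2 ->]]]]]]]]]|x xH]; apply/asboolP.
- exists 0, 0, 0, 0, 0, 0, 0, 0; split; first by split; lia.
  by apply: mnm3P; rewrite mnm0E.
- exists (d + d'), (J + J'), (v0 + v0'), (v1 + v1'), (v2 + v2').
  exists (c0 + c0'), (c1 + c1'), (c2 + c2'); split.
    by case: S1 S2 => ? ? ? ? ? [? ? ? ? ?]; split; rewrite ?mulnDr; lia.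
  by rewrite mnm3D; congr mnm3; lia.
move: xH => /(H3_gensP _ t_gt0)[j jt [] ->].
- exists 1, j, (t - j), 0, 0, 1, 0, 0; split; last by congr mnm3; lia.
  by split; lia.
- exists 1, j, 0, (t - j), 0, 0, 1, 0; split; last by congr mnm3; lia.
  by split; lia.
- exists 1, j, 0, 0, (t - j), 0, 0, 1; split; last by congr mnm3; lia.
  by split; lia.
Qed.

(** Among the residue classes modulo 3t that meet H_3t, these are the ones in
    which the vector of residues itself lies outside H_3t, the low coordinate
    being that of a. *)
Definition low a b c := (a %% n + b %% n + c %% n == n) && (a %% n < b %% n) && (a %% n < c %% n).

(** With a, b, c the three coordinates of the sum: if a < n then
    d = 1 + b %/ n + c %/ n, whereas v1 and v2 need at least 1 + b %/ n and
    1 + c %/ n pieces, since J <= a is below both residues. *)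
Lemma H3_sum_low d J v0 v1 v2 c0 c1 c2 : H3_sum d J v0 v1 v2 c0 c1 c2 ->
  low (J + 3 * v0) (J + 3 * v1) (J + 3 * v2) -> n <= J + 3 * v0.
Proof.
case=> h0 h1 h2 hc hJ /andP[/andP[/eqP]]; rewrite [n <= _]leqNgt => hr hb hc'.
apply/negP => an; move: hr hb hc'; rewrite (modn_small an).
have := divn_eq (J + 3 * v1) n; have := divn_eq (J + 3 * v2) n.
set r1 := (J + 3 * v1) %% n; set r2 := (J + 3 * v2) %% n.
set q1 := (J + 3 * v1) %/ n; set q2 := (J + 3 * v2) %/ n => e2 e1 hr hb hc'.
have q1c : q1 < c1.
  by rewrite -(ltn_pmul2l t_gt0); apply: leq_trans h1; move: e1; rewrite /n; lia.
have q2c : q2 < c2.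
  by rewrite -(ltn_pmul2l t_gt0); apply: leq_trans h2; move: e2; rewrite /n; lia.
have dE : d = q1 + q2 + 1.
  by apply/eqP; rewrite -(eqn_pmul2l t_gt0) !mulnDr; apply/eqP; move: e1 e2 hr; rewrite /n; lia.
lia.
Qed.

(** Using m as often as possible, J = a times, is optimal. The number of pieces
    then needed stays within d = (a + b + c) / n, except if a < n and both other
    residues exceed a and the residues sum to n only. *)
Lemma H3_sum_of_min a b c : a <= b -> a <= c ->
  n %| a + b + c -> a = b %[mod 3] -> a = c %[mod 3] -> (low a b c -> n <= a) ->
  exists d J v0 v1 v2 c0 c1 c2, H3_sum d J v0 v1 v2 c0 c1 c2 /\
    [/\ a = J + 3 * v0, b = J + 3 * v1 & c = J + 3 * v2].
Proof.
move=> ab ac /dvdnP[d dE] ab3 ac3 hlow; have n_gt0 : 0 < n by rewrite /n; lia.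
have [v1 bE] : exists v, b = a + 3 * v by exists ((b - a) %/ 3); lia.
have [v2 cE] : exists v, c = a + 3 * v by exists ((c - a) %/ 3); lia.
have := divn_eq a n; have := divn_eq b n; have := divn_eq c n.
have := ltn_pmod a n_gt0; have := ltn_pmod b n_gt0; have := ltn_pmod c n_gt0.
move: hlow; rewrite /low.
have := leq_div2r n ab; have := leq_div2r n ac.
move: (a %% n) (b %% n) (c %% n) (a %/ n) (b %/ n) (c %/ n) => r0 r1 r2 q0 q1 q2.
move=> q02 q01 hlow r2n r1n r0n c_eq b_eq a_eq.
have [s sE] : exists s, r0 + r1 + r2 = s * n.
  exists (d - (q0 + q1 + q2)); rewrite mulnBl !mulnDl; lia.
have dE' : d = q0 + q1 + q2 + s.
  by apply/eqP; rewrite -(eqn_pmul2r n_gt0) !mulnDl; apply/eqP; lia.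
exists d, a, 0, v1, v2, 0, (q1 - q0 + (r0 < r1)), (q2 - q0 + (r0 < r2)).
split; last by split; lia.
have cost r q v : a + 3 * v = q * n + r -> r < n -> q0 <= q -> v <= t * (q - q0 + (r0 < r)).
  move=> e rn q0q; rewrite mulnDr mulnBr.
  have : t * q0 <= t * q by rewrite leq_mul2l q0q orbT.
  move: e a_eq rn; rewrite /n !(mulnC _ (3 * t)) -!mulnA.
  by case: ltnP => r0r; rewrite ?muln1 ?muln0; lia.
split; rewrite ?muln0 //.
- by apply: cost; rewrite -?bE.
- by apply: cost; rewrite -?cE.
- have [q0_gt0|] := ltnP 0 q0.
    by rewrite dE'; case: (r0 < r1); case: (r0 < r2); lia.
  rewrite leqn0 => /eqP q00; move: a_eq; rewrite q00 mul0n add0n => a_eq.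
  case: s sE dE' => [|[|s]] sE dE'; rewrite ?mul0n ?mul1n in sE.
  + have [-> -> ->] : [/\ r0 = 0, r1 = 0 & r2 = 0] by split; lia.
    by rewrite ltnn; lia.
  + have : ~~ ((r0 < r1) && (r0 < r2)).
      apply/negP => h; have : n <= a by apply: hlow; rewrite sE eqxx -andbA h.
      lia.
    by case: (r0 < r1); case: (r0 < r2) => // _; lia.
  + by case: (r0 < r1); case: (r0 < r2); lia.
- by move: dE; rewrite /n; lia.
Qed.

Lemma lowC a b c : low a b c = low a c b.
Proof. by rewrite /low addnAC -!andbA; congr andb; rewrite andbC. Qed.

(** In each residue class modulo 3t, membership amounts to at most one lower
    bound on one coordinate, so that the class meets H_3t in a translate of
    3t * N^3 or not at all. This is what makes the semigroup ring free over the
    polynomial ring in the 3t-th powers of the variables. *)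
Lemma mem_H3 a b c : mnm3 a b c \in H <->
  [/\ n %| a + b + c, a = b %[mod 3], a = c %[mod 3] &
  [/\ low a b c -> n <= a, low b a c -> n <= b & low c b a -> n <= c]].
Proof.
split=> [/mem_H3_sum[d [J [v0 [v1 [v2 [c0 [c1 [c2 [S E]]]]]]]]]|].
  have [-> -> ->] : [/\ a = J + 3 * v0, b = J + 3 * v1 & c = J + 3 * v2].
    have e i : mnm3 a b c i = mnm3 (J + 3 * v0) (J + 3 * v1) (J + 3 * v2) i by rewrite E.
    by split; [apply: (e 0%R) | apply: (e 1%R) | apply: (e 2%R)].
  split; try lia; last first.
    split; first exact: H3_sum_low S.
      exact: H3_sum_low (H3_sum10 S).
    exact: H3_sum_low (H3_sum20 S).
  apply/dvdnP; exists d; case: S => _ _ _ _; rewrite /n; lia.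
case=> dvd ab3 ac3 [la lb lc].
have [/andP[ab ac]|nmin_a] := boolP ((a <= b) && (a <= c)).
  have [d [J [v0 [v1 [v2 [c0 [c1 [c2 [S [-> -> ->]]]]]]]]]] := H3_sum_of_min ab ac dvd ab3 ac3 la.
  exact: H3_sum_mem S.
have [/andP[ba bc]|nmin_b] := boolP ((b <= a) && (b <= c)).
  have [||||d [J [v0 [v1 [v2 [c0 [c1 [c2 [S [-> -> ->]]]]]]]]]] 
    := @H3_sum_of_min b a c ba bc => //; first (by rewrite [b + a]addnC); try lia.
  exact: H3_sum_mem (H3_sum10 S).
have [ca cb] : c <= a /\ c <= b by lia.
have [||||d [J [v0 [v1 [v2 [c0 [c1 [c2 [S [-> -> ->]]]]]]]]]] 
  := @H3_sum_of_min c b a cb ca => //; first (by rewrite addnC addnA addnAC); try lia.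
exact: H3_sum_mem (H3_sum20 S).
Qed.

End Semigroup.

(** * A regular sequence of length three *)

Section LinearExtension.
Variables (k : fieldType) (n : nat) (F : 'X_{1..n} -> {mpoly k[n]}).

Definition mlin (p : {mpoly k[n]}) : {mpoly k[n]} := \sum_(m <- msupp p) p@_m *: F m.

Lemma mlin_supset (p : {mpoly k[n]}) s : uniq s -> {subset msupp p <= s} ->
  mlin p = \sum_(m <- s) p@_m *: F m.
Proof.
move=> us ps; rewrite [RHS](bigID (fun m => m \in msupp p)) /= addrC big1 ?add0r.
  rewrite -big_filter; apply/perm_big/uniq_perm; rewrite ?msupp_uniq ?filter_uniq // => m.
  by rewrite mem_filter; case: (boolP (m \in msupp p)) => // /ps ->.
by move=> m mp; rewrite memN_msupp_eq0 ?scale0r.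
Qed.

Lemma mlin_is_linear : linear mlin.
Proof.
move=> a p q; pose s := undup (msupp p ++ msupp q).
have us : uniq s by apply: undup_uniq.
have ps : {subset msupp p <= s} by move=> m mp; rewrite mem_undup mem_cat mp.
have qs : {subset msupp q <= s} by move=> m mq; rewrite mem_undup mem_cat mq orbT.
have pqs : {subset msupp (a *: p + q) <= s}.
  move=> m /msuppD_le; rewrite mem_cat => /orP[/msuppZ_le/ps //|/qs //].
rewrite (mlin_supset us ps) (mlin_supset us qs) (mlin_supset us pqs).
rewrite scaler_sumr -big_split; apply: eq_bigr => m _ /=.
by rewrite mcoeffD mcoeffZ scalerDl scalerA.
Qed.

HB.instance Definition _ :=
  GRing.isLinear.Build k {mpoly k[n]} {mpoly k[n]} *:%R mlin mlin_is_linear.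

Lemma mlinX m : mlin 'X_[m] = F m.
Proof. by rewrite /mlin msuppX big_seq1 mcoeffX eqxx scale1r. Qed.

End LinearExtension.

Section Retraction.
Variables (k : fieldType) (n : nat) (gs : seq 'X_{1..n}).
Let H : {pred 'X_{1..n}} := semigroup_gen gs.
Let S : {pred {mpoly k[n]}} := @monomial_span k n H.

HB.instance Definition _ := GRing.isSubringClosed.Build {mpoly k[n]}
  (@monomial_span k n (semigroup_gen gs)) (monomial_span_subring k gs).

Lemma monomial_spanX m : m \in H -> 'X_[m] \in S.
Proof. by move=> mH; apply/monomial_spanP => h; rewrite msuppX inE => /eqP ->. Qed.

Lemma monomial_spanZ (a : k) p : p \in S -> a *: p \in S.
Proof. by move=> /monomial_spanP pS; apply/monomial_spanP => m /msuppZ_le/pS. Qed.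

Lemma monomial_span_ind (P : {mpoly k[n]} -> Prop) :
  P 0 -> (forall a p q, P p -> P q -> P (a *: p + q)) ->
  (forall m, m \in H -> P 'X_[m]) -> forall p, p \in S -> P p.
Proof.
move=> P0 PD PX p /monomial_spanP pH; rewrite [p]mpolyE big_seq.
elim/big_ind: _ => // [u v Pu Pv|m /pH/PX Pm].
  by rewrite -[u]scale1r; apply: PD.
by rewrite -[_ *: _]addr0; apply: PD.
Qed.

Lemma linear_eq_span (f h : {mpoly k[n]} -> {mpoly k[n]}) : linear f -> linear h ->
  (forall m, m \in H -> f 'X_[m] = h 'X_[m]) -> {in S, f =1 h}.
Proof.
have lin0 (e : {mpoly k[n]} -> {mpoly k[n]}) : linear e -> e 0 = 0.
  by move=> le; have := le (-1) 0 0; rewrite scaler0 addr0 scaleN1r addNr.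
move=> lf lh fh; apply: monomial_span_ind => [|a p q Ep Eq|//]; first by rewrite !lin0.
by rewrite lf lh Ep Eq.
Qed.

(** The orbits of translation by g on H have a lowest element each, the foot,
    and u counts the steps up from it: the feet are a basis of the semigroup
    ring over the polynomial ring in 'X_[g]. *)
Definition height (g : 'X_{1..n}) (u : 'X_{1..n} -> nat) : Prop := g \in H /\
  forall h, h \in H -> u (h + g)%MM = (u h).+1 /\
    exists2 h', h' \in H & h = (h' + g *+ u h)%MM.

Variables (g : 'X_{1..n}) (u : 'X_{1..n} -> nat) (a : k).
Hypothesis ug : height g u.

(** Reduction modulo 'X_[g] - a, sending each monomial to the foot of its
    g-line. *)
Definition retract : {mpoly k[n]} -> {mpoly k[n]} :=
  mlin (fun h => a ^+ u h *: 'X_[h - g *+ u h]).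
HB.instance Definition _ := GRing.Linear.on retract.

Let footE h h' : h = (h' + g *+ u h)%MM -> (h - g *+ u h)%MM = h'.
Proof. by move=> {1}->; rewrite addmK. Qed.

Lemma retract_span p : p \in S -> retract p \in S.
Proof.
move: p; apply: (monomial_span_ind (P := fun p => retract p \in S)) => [|b q r qS rS|m mH].
  by rewrite linear0 rpred0.
  by rewrite linearP rpredD // monomial_spanZ.
have [_ [m' m'H /footE E]] := ug.2 m mH.
by rewrite /retract mlinX E monomial_spanZ // monomial_spanX.
Qed.

Lemma retract_mulX p : p \in S -> retract ('X_[g] * p) = a *: retract p.
Proof.
move: p; suff e : {in S, (fun p => retract ('X_[g] * p)) =1 (fun p => a *: retract p)}
  by move=> p /e.
apply: linear_eq_span.
- by move=> b p q; rewrite mulrDr -scalerAr linearP.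
- by move=> b p q; rewrite linearP scalerDr !scalerA mulrC.
move=> m mH.
have [E [m' m'H Em]] := ug.2 m mH; rewrite -mpolyXD addmC /retract !mlinX E.
rewrite (footE Em) exprS -scalerA; congr (_ *: (_ *: 'X_[_])).
by rewrite {1}Em mulmS [(g + _)%MM]addmC -addmA addmK.
Qed.

Lemma retract_mul_fixed g' p : (forall h, h \in H -> u (h + g')%MM = u h) -> p \in S ->
  retract ('X_[g'] * p) = 'X_[g'] * retract p.
Proof.
move=> ug'; move: p.
suff e : {in S, (fun p => retract ('X_[g'] * p)) =1 (fun p => 'X_[g'] * retract p)} by move=> p /e.
apply: linear_eq_span.
- by move=> b p q; rewrite mulrDr -scalerAr linearP.
- by move=> b p q; rewrite linearP mulrDr -scalerAr.
move=> m mH.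
have [_ [m' m'H Em]] := ug.2 m mH; rewrite -mpolyXD addmC /retract !mlinX ug' //.
rewrite (footE Em) -scalerAr -mpolyXD; congr (_ *: 'X_[_]).
by rewrite {1}Em -addmA [(_ + g')%MM]addmC addmA addmK addmC.
Qed.

Lemma retract_diff p : p \in S ->
  exists2 q, q \in S & p - retract p = ('X_[g] - a%:MP) * q.
Proof.
move: p; apply: (monomial_span_ind (P := fun p =>
  exists2 q, q \in S & p - retract p = ('X_[g] - a%:MP) * q))
  => [|b q r [q' q'S Eq] [r' r'S Er]|m mH].
- by exists 0; rewrite ?rpred0 // linear0 subrr mulr0.
- exists (b *: q' + r'); first by rewrite rpredD ?monomial_spanZ.
  rewrite linearP mulrDr -scalerAr -Eq -Er scalerBr addrACA -opprD.
  by [].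
- have [_ [m' m'H Em]] := ug.2 m mH.
  exists ((\sum_(i < u m) 'X_[g] ^+ ((u m).-1 - i) * a%:MP ^+ i) * 'X_[m']).
    rewrite rpredM ?monomial_spanX // rpred_sum // => i _.
    rewrite rpredM ?rpredX ?monomial_spanX //; first by case: ug.
    by rewrite -[a%:MP]mulr1 mul_mpolyC monomial_spanZ ?rpred1.
  rewrite mulrA -subrXX /retract mlinX (footE Em) {1}Em mpolyXD mpolyXn mulrBl.
  by rewrite -mul_mpolyC rmorphXn mulrC.
Qed.

End Retraction.

Section RegularSequence.
Variables (k : fieldType) (n : nat) (gs : seq 'X_{1..n}).
Let H : {pred 'X_{1..n}} := semigroup_gen gs.
Let S : {pred {mpoly k[n]}} := @monomial_span k n H.
Let R := semigroup_ring k gs.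

Lemma semigroup_ring_val (x : R) : sgr_val x \in S.
Proof. by case: x. Qed.

Lemma semigroup_ring_lift (p : {mpoly k[n]}) : p \in S -> exists x : R, sgr_val x = p.
Proof. by move=> pS; exists (SemigroupRing pS). Qed.

Lemma retract_kill g u a p : height gs g u -> p \in S ->
  retract g u a (('X_[g] - a%:MP) * p) = 0.
Proof.
by move=> ug pS; rewrite mulrBl mul_mpolyC linearB linearZ /= (retract_mulX _ ug) ?subrr.
Qed.

Lemma retract_mul_fixedB g u a g' b p : height gs g u ->
  (forall h, h \in H -> u (h + g')%MM = u h) -> p \in S ->
  retract g u a (('X_[g'] - b%:MP) * p) = ('X_[g'] - b%:MP) * retract g u a p.
Proof.
move=> ug ug' pS.
by rewrite !mulrBl !mul_mpolyC linearB linearZ /= (retract_mul_fixed _ ug ug').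
Qed.

Lemma monomial_subC_neq0 (g : 'X_{1..n}) (a : k) : g != 0%MM -> 'X_[g] - a%:MP != 0.
Proof.
move=> g0; apply: contra_neq (oner_neq0 k) => /(congr1 (mcoeff g)).
by rewrite mcoeffB mcoeffX mcoeffC eqxx (negPf g0) mulr0 subr0 mcoeff0.
Qed.

(** Reduce a relation modulo x0, ..., x_(i-1) by applying the corresponding
    retractions: these kill the right-hand side and commute with x_i, which is
    not a zero divisor. *)
Lemma height_regular (g0 g1 g2 : 'X_{1..n}) u0 u1 (a0 a1 a2 : k) (x0 x1 x2 : R) :
  height gs g0 u0 -> height gs g1 u1 ->
  (forall h, h \in H -> u0 (h + g1)%MM = u0 h) ->
  (forall h, h \in H -> u0 (h + g2)%MM = u0 h) ->
  (forall h, h \in H -> u1 (h + g2)%MM = u1 h) ->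
  g0 != 0%MM -> g1 != 0%MM -> g2 != 0%MM ->
  sgr_val x0 = 'X_[g0] - a0%:MP -> sgr_val x1 = 'X_[g1] - a1%:MP -> sgr_val x2 = 'X_[g2] - a2%:MP ->
  1 \notin ideal_gen [:: x0; x1; x2] -> regular_seq [:: x0; x1; x2].
Proof.
move=> h0 h1 u01 u02 u12 g0n g1n g2n E0 E1 E2 one; split=> //.
have gen0 (y : R) : y \in ideal_gen [::] -> y = 0.
  by move=> /asboolP[c ->]; rewrite big_ord0.
have gen1 (x y : R) : y \in ideal_gen [:: x] -> exists b, y = b * x.
  by move=> /(@ideal_gen_rcons _ [::])[z /gen0 -> [b ->]]; exists b; rewrite add0r.
have nzd (g : 'X_{1..n}) (a : k) (p : {mpoly k[n]}) : g != 0%MM ->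
    ('X_[g] - a%:MP) * p = 0 -> p = 0.
  move=> gn; have /negPf e := monomial_subC_neq0 a gn.
  by move=> /eqP; rewrite mulf_eq0 e => /eqP.
have valS := semigroup_ring_val.
case=> [|[|[|//]]] _ x; rewrite ?take0 /=.
- move=> /gen0 /(congr1 val); rewrite rmorphM rmorph0 /= E0 => /(nzd _ _ _ g0n) vx.
  have -> : x = 0 by apply: val_inj; rewrite rmorph0.
  by have [] := ideal_gen_ideal ([::] : seq R).
- case/gen1=> b /(congr1 val); rewrite !rmorphM /= E0 E1 [_ * ('X_[g0] - _)]mulrC.
  move=> /(congr1 (retract g0 u0 a0)).
  rewrite (retract_mul_fixedB _ _ h0 u01) // (retract_kill _ h0) // => /(nzd _ _ _ g1n) r0.
  have [q /semigroup_ring_lift[y <-]] := retract_diff a0 h0 (valS x).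
  rewrite r0 subr0 => Ex; have -> : x = y * x0.
    by apply: val_inj; rewrite rmorphM /= Ex E0 mulrC.
  by apply: is_idealM; [apply: ideal_gen_ideal | apply: mem_ideal_gen; rewrite mem_head].
- case/(@ideal_gen_rcons _ [:: x0])=> _ /gen1[b ->] [c].
  move=> /(congr1 val); rewrite rmorphD !rmorphM /= E0 E1 E2.
  rewrite [_ * ('X_[g0] - _)]mulrC [_ * ('X_[g1] - _)]mulrC.
  have rS y := retract_span a0 h0 (valS y).
  move=> /(congr1 (retract g0 u0 a0)); rewrite linearD /= (retract_mul_fixedB _ _ h0 u02) //.
  rewrite (retract_kill _ h0) // add0r (retract_mul_fixedB _ _ h0 u01) //.
  move=> /(congr1 (retract g1 u1 a1)); rewrite (retract_mul_fixedB _ _ h1 u12) //.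
  rewrite (retract_kill _ h1) // => /(nzd _ _ _ g2n) r0.
  have [q /semigroup_ring_lift[y <-] Ey] := retract_diff a0 h0 (valS x).
  have [r /semigroup_ring_lift[z <-]] := retract_diff a1 h1 (rS x).
  rewrite r0 subr0 => Ez; have -> : x = y * x0 + z * x1.
    apply: val_inj; rewrite rmorphD !rmorphM /= E0 E1 [_ * ('X_[g0] - _)]mulrC -Ey.
    by rewrite [_ * ('X_[g1] - _)]mulrC -Ez subrK.
  have idG := ideal_gen_ideal [:: x0; x1].
  by apply: is_idealD => //; apply: is_idealM => //; apply: mem_ideal_gen;
    rewrite !inE eqxx ?orbT.
Qed.

Definition sgr_const (a : k) : R := insubd 0 a%:MP.

Lemma val_sgr_const a : val (sgr_const a) = a%:MP.
Proof.
by rewrite insubdK // -[a%:MP]mulr1 mul_mpolyC monomial_spanZ // rpred1.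
Qed.

Lemma sgr_const_zmod_morphism : zmod_morphism sgr_const.
Proof. by move=> a b; apply: val_inj; rewrite rmorphB /= !val_sgr_const rmorphB. Qed.

Lemma sgr_const_monoid_morphism : monoid_morphism sgr_const.
Proof.
split=> [|a b]; apply: val_inj; first by rewrite val_sgr_const !rmorph1.
by rewrite rmorphM /= !val_sgr_const rmorphM.
Qed.

HB.instance Definition _ := GRing.isZmodMorphism.Build k R sgr_const sgr_const_zmod_morphism.
HB.instance Definition _ := GRing.isMonoidMorphism.Build k R sgr_const sgr_const_monoid_morphism.

Definition sgr_mono (m : 'X_{1..n}) : R := insubd 0 'X_[m].

Lemma val_sgr_mono m : m \in H -> val (sgr_mono m) = 'X_[m].
Proof. by move=> mH; rewrite insubdK // monomial_spanX. Qed.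

Lemma semigroup_ring_generated : generated_by sgr_const (map sgr_mono gs).
Proof.
move=> D cD constD monoD.
have [E ED] : exists E : subringClosed R, E =i D.
  exists (HB.pack_for (subringClosed R) (D : R -> bool) (GRing.isSubringClosed.Build R D cD)).
  by [].
pose T : {pred 'X_{1..n}} := fun m => (m \in H) && (sgr_mono m \in E).
have monoE : {subset H <= T}.
  apply: semigroup_gen_min => [|m1 m2 /andP[m1H m1E] /andP[m2H m2E]|m mgs]; apply/andP; split.
  - exact: semigroup_gen0.
  - have -> : sgr_mono 0%MM = 1; last exact: rpred1.
    by apply: val_inj; rewrite val_sgr_mono ?semigroup_gen0 // mpolyX0 rmorph1.
  - exact: semigroup_genD.
  - have -> : sgr_mono (m1 + m2)%MM = sgr_mono m1 * sgr_mono m2; last exact: rpredM.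
    apply: val_inj; rewrite rmorphM /= -!/(val _) !val_sgr_mono ?semigroup_genD //.
    exact: mpolyXD.
  - exact: mem_semigroup_gen.
  - by rewrite ED monoD // map_f.
pose P p := exists2 x : R, val x = p & x \in E.
have PS : forall p, p \in S -> P p.
  apply: monomial_span_ind => [|a _ _ [x <- xE] [y <- yE]|m mH].
  - by exists 0; rewrite ?rmorph0 ?rpred0.
  - exists (sgr_const a * x + y); last by rewrite rpredD ?rpredM // ED constD.
    by rewrite rmorphD rmorphM /= val_sgr_const mul_mpolyC.
  - by exists (sgr_mono m); [apply: val_sgr_mono | by have /andP[] := monoE m mH].
by move=> x; have [y /val_inj <-] := PS _ (semigroup_ring_val x); rewrite ED.
Qed.

End RegularSequence.

Lemma maximal_ideal_value (k : closedFieldType) n (gs : seq 'X_{1..n})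
    (M : prime_idealr (semigroup_ring k gs)) (x : semigroup_ring k gs) :
  maximal_ideal M -> exists a, x - sgr_const gs a \in M.
Proof.
move=> /residue_field[K [f [fsurj fM]]].
have [|a fx] := @nullstellensatz k K (f \o @sgr_const k n gs)
  (map f (map (@sgr_mono k n gs) gs)) _ (f x).
  move=> D cD constD monoD y; have [z <-] := fsurj y.
  pose E : {pred semigroup_ring k gs} := fun z => f z \in D.
  suff : z \in E by [].
  have [D1 DB DM] := cD; apply: semigroup_ring_generated z => [|a|_ /mapP[m mgs ->]].
  - split=> [|u v uE vE|u v uE vE]; rewrite unfold_in ?rmorph1 //.
      by rewrite rmorphB; apply: DB.
    by rewrite rmorphM; apply: DM.
  - exact: constD.
  - by apply: monoD; do 2 apply: map_f.
by exists a; rewrite -fM rmorphB fx /= subrr.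
Qed.

(** At a maximal ideal M, the three monomials minus their values at M form a
    regular sequence in M, and no chain of primes is longer because the ring
    embeds into a polynomial ring in three variables. *)
Theorem height_cohen_macaulay (k : closedFieldType) (gs : seq 'X_{1..3})
    (g0 g1 g2 : 'X_{1..3}) u0 u1 :
  height gs g0 u0 -> height gs g1 u1 -> g2 \in semigroup_gen gs ->
  (forall h, h \in semigroup_gen gs -> u0 (h + g1)%MM = u0 h) ->
  (forall h, h \in semigroup_gen gs -> u0 (h + g2)%MM = u0 h) ->
  (forall h, h \in semigroup_gen gs -> u1 (h + g2)%MM = u1 h) ->
  g0 != 0%MM -> g1 != 0%MM -> g2 != 0%MM ->
  cohen_macaulay (semigroup_ring k gs).
Proof.
move=> h0 h1 g2H u01 u02 u12 g0n g1n g2n.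
set R := semigroup_ring k gs; pose c : {rmorphism k -> R} := @sgr_const k 3 gs.
have nR : noetherian R := noetherian_generated (c := c) (@semigroup_ring_generated k 3 gs).
split=> // M maxM; have locM := loc_of_localization M.
apply: (@cohen_macaulay_local_of _ (@loc_max _ _ M (@loc_of _ M)) 3).
- exact: noetherian_localization locM nR.
- exact: loc_max_local locM.
- have [a0 M0] := maximal_ideal_value (sgr_mono k gs g0) maxM.
  have [a1 M1] := maximal_ideal_value (sgr_mono k gs g1) maxM.
  have [a2 M2] := maximal_ideal_value (sgr_mono k gs g2) maxM.
  pose s := [:: sgr_mono k gs g0 - sgr_const gs a0; sgr_mono k gs g1 - sgr_const gs a1;
    sgr_mono k gs g2 - sgr_const gs a2].
  have sM : {subset s <= M} by move=> x; rewrite !inE => /or3P[] /eqP ->.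
  have vE g a : g \in semigroup_gen gs ->
      sgr_val (sgr_mono k gs g - sgr_const gs a) = 'X_[g] - a%:MP.
    by move=> gH; rewrite -(val_sgr_const gs) -(val_sgr_mono k gH).
  have s_reg : regular_seq s.
    apply: (height_regular h0 h1 u01 u02 u12 g0n g1n g2n
      (vE g0 a0 h0.1) (vE g1 a1 h1.1) (vE g2 a2 g2H)).
    by apply/negP => /(ideal_gen_min (idealrP M) sM); rewrite idealr1.
  have [locs_reg sN] := regular_seq_localization locM s_reg sM.
  by exists (map (@loc_of _ M) s).
- move=> m P; apply: (localization_chain_leq (v := \val) (c := c)) locM.
  + exact: val_inj.
  + exact: val_sgr_const.
Qed.

(** * Heights on H_3t *)

Section Heights.
Local Open Scope nat_scope.
Variable t : nat.
Hypothesis t_gt0 : 0 < t.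
Let n := 3 * t.
Let H : {pred 'X_{1..3}} := semigroup_gen (H3_gens t).

Let n_gt0 : 0 < n. Proof. by rewrite muln_gt0. Qed.

Let explicit a b c := [/\ n %| a + b + c, a = b %[mod 3], a = c %[mod 3] &
  [/\ low t a b c -> n <= a, low t b a c -> n <= b & low t c b a -> n <= c]].

Let explicit_swap a b c : explicit a b c -> explicit b a c.
Proof.
case=> dvd ab ac [la lb lc]; split; [by rewrite [b + a]addnC | by [] | by rewrite -ab |].
by split=> //; rewrite lowC.
Qed.

Lemma low_modn a b c a' b' c' : a = a' %[mod n] -> b = b' %[mod n] -> c = c' %[mod n] ->
  low t a b c = low t a' b' c'.
Proof. by rewrite /low -/n => -> -> ->. Qed.

(** The number of steps of length n from (a, b, c) down to the foot of its
    line. On the semigroup the subtraction does not truncate: when the residues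
    are low, the foot has first coordinate at least n. *)
Definition axis_height a b c := a %/ n - low t a b c.

Let axis_foot a b c (q := axis_height a b c) : explicit a b c ->
  [/\ axis_height (a + n) b c = q.+1, n * q <= a & explicit (a - n * q) b c].
Proof.
case=> dvd ab ac [la lb lc]; have low_le : low t a b c <= a %/ n.
  by case: (low t a b c) la => // /(_ isT); rewrite divn_gt0.
have nq : n * q <= a.
  by apply: leq_trans (leq_divM a n); rewrite mulnC leq_mul2r leq_subr orbT.
have aq : a = a - n * q %[mod n].
  by rewrite -{1}(subnK nq) addnC [X in X + _ = _ %[mod _]]mulnC modnMDl.
have aq3 : a = a - n * q %[mod 3].
  by rewrite -{1}(subnK nq) addnC {1}/n mulnAC mulnC [3 * q]mulnC mulnA modnMDl.
split=> //.
  rewrite /axis_height (@low_modn (a + n) b c a b c) ?modnDr //.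
  by rewrite divnDr // divnn n_gt0 addn1 subSn.
split; rewrite -?aq3 //.
  by rewrite -(dvdn_addl _ (dvdn_mulr q (dvdnn n))) addnAC [X in X + c]addnAC subnK.
rewrite -(low_modn aq (erefl (b %% n)) (erefl (c %% n))).
rewrite -(low_modn (erefl (b %% n)) aq (erefl (c %% n))).
rewrite -(low_modn (erefl (c %% n)) (erefl (b %% n)) aq).
split=> // lowa; have := la lowa; rewrite /q /axis_height lowa => na.
rewrite mulnBr muln1 subnBA; last by rewrite -{1}[n]muln1 leq_mul2l divn_gt0 // na orbT.
by rewrite addnC -addnBA ?leq_addr // mulnC leq_divM.
Qed.

Definition height0 (m : 'X_{1..3}) := axis_height (m 0%R) (m 1%R) (m 2%R).
Definition height1 (m : 'X_{1..3}) := axis_height (m 1%R) (m 0%R) (m 2%R).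

Let mnm3K a b c :
  (mnm3 a b c 0%R = a) * (mnm3 a b c 1%R = b) * (mnm3 a b c 2%R = c).
Proof. by []. Qed.

Let mnm3M a b c q : (mnm3 a b c *+ q)%MM = mnm3 (a * q) (b * q) (c * q).
Proof. by apply: mnm3P; rewrite mulmnE. Qed.

Lemma mem_axis m : m \in [:: mnm3 n 0 0; mnm3 0 n 0; mnm3 0 0 n] -> m \in H.
Proof.
move=> mE; apply/mem_semigroup_gen/H3_gensP => //; exists 0 => //; rewrite subn0 !add0n -/n.
by move: mE; rewrite !inE => /or3P[] /eqP ->; [apply: Or31 | apply: Or32 | apply: Or33].
Qed.

Lemma height0P : height (H3_gens t) (mnm3 n 0 0) height0.
Proof.
split=> [|h]; first by apply: mem_axis; rewrite // !inE eqxx.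
rewrite [h]mnm3E; move: (h 0%R) (h 1%R) (h 2%R) => a b c /(mem_H3 t_gt0)/axis_foot[E nq hH].
rewrite mnm3D !addn0 /height0 !mnm3K; split=> //.
exists (mnm3 (a - n * axis_height a b c) b c); first exact/(mem_H3 t_gt0).
by rewrite mnm3M mnm3D !mul0n !addn0 subnK.
Qed.

Lemma height1P : height (H3_gens t) (mnm3 0 n 0) height1.
Proof.
split=> [|h]; first by apply: mem_axis; rewrite // !inE eqxx orbT.
rewrite [h]mnm3E; move: (h 0%R) (h 1%R) (h 2%R) => a b c.
move=> /(mem_H3 t_gt0)/explicit_swap/axis_foot[E nq hH].
rewrite mnm3D !addn0 /height1 !mnm3K; split=> //.
exists (mnm3 a (b - n * axis_height b a c) c); first exact/(mem_H3 t_gt0)/explicit_swap.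
by rewrite mnm3M mnm3D !mul0n !addn0 subnK.
Qed.

(** Hence heights do not change along the other two axes, which makes the
    reductions along different axes compatible. *)
Lemma axis_height_modn a b c b' c' : b = b' %[mod n] -> c = c' %[mod n] ->
  axis_height a b c = axis_height a b' c'.
Proof. by move=> bb cc; rewrite /axis_height (low_modn (erefl _) bb cc). Qed.

End Heights.

Theorem theorem5p10 (k : closedFieldType) (char0 : [pchar k]%R =i pred0)
    (t : nat) (ht : (1 <= t)%N) :
  cohen_macaulay (semigroup_ring k (H3_gens t)).
Proof.
have n0 : (3 * t != 0)%N by rewrite muln_eq0 -lt0n.
apply: (height_cohen_macaulay k (height0P ht) (height1P ht) (g2 := mnm3 0 0 (3 * t))).
- by apply: mem_axis; rewrite // !inE eqxx !orbT.
- move=> h _; rewrite [h]mnm3E mnm3D !addn0; apply: axis_height_modn => //.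
  by rewrite /= modnDr.
- move=> h _; rewrite [h]mnm3E mnm3D !addn0; apply: axis_height_modn => //.
  by rewrite /= modnDr.
- move=> h _; rewrite [h]mnm3E mnm3D !addn0; apply: axis_height_modn => //.
  by rewrite /= modnDr.
- by apply: contraNneq n0 => /(congr1 (fun m : 'X_{1..3} => m 0%R)) e; apply/eqP;
    apply: etrans e (mnm0E _).
- by apply: contraNneq n0 => /(congr1 (fun m : 'X_{1..3} => m 1%R)) e; apply/eqP;
    apply: etrans e (mnm0E _).
- by apply: contraNneq n0 => /(congr1 (fun m : 'X_{1..3} => m 2%R)) e; apply/eqP;
    apply: etrans e (mnm0E _).
Qed.
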